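(* Let $m\ge 1$ and $0\le n\le m/2$ be integers and let $\tau=\{\tau_1,\dots,\tau_m\}$ be a set of $m$ distinct nonzero complex numbers. Let $\mathcal Y_{n,\tau}\subset\mathfrak{sp}_{2m}(\mathbb C)$ be the fiber over $\tau$ of the adjoint quotient restricted to the slice $\mathcal S_n$ (both defined in the context), and let $\Sigma_\tau$ be the affine surface $$\Sigma_\tau=\{(u,v,z)\in\mathbb C^3\mid P_\tau(z)+u^2+zv^2=0\},\qquad P_\tau(z)=\prod_{k=1}^m(z-\tau_k).$$ Then there is an open holomorphic embedding $$j:\mathcal Y_{n,\tau}\to\mathrm{Hilb}^n(\Sigma_\tau).$$
   Context: $\mathfrak{sp}_{2m}(\mathbb C)$ is the Lie algebra of block matrices $\begin{pmatrix}P&Q\\ R&-P^{\top}\end{pmatrix}$ with $P,Q,R$ complex $m\times m$ matrices, $Q,R$ symmetric. $\mathfrak h\cong\mathbb C^m$ is its diagonal Cartan subalgebra and $W$ its Weyl group; $\mathfrak h/W$ is identified with $\mathrm{Sym}_m(\mathbb C)=\mathbb C^m/S_m$ by $[\mathrm{diag}(x_1,\dots,x_m,-x_1,\dots,-x_m)]\mapsto\{x_1^2,\dots,x_m^2\}$. The adjoint quotient $\chi:\mathfrak{sp}_{2m}(\mathbb C)\to\mathfrak h/W$ sends $Y$ to the class of any element of $\mathfrak h$ conjugate to the semisimple part of $Y$; thus $\chi(Y)=\tau$ iff $\det(tI-Y)=\prod_k(t^2-\tau_k)$. $\mathrm{Hilb}^n(\Sigma)$ is the Hilbert scheme of length-$n$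 zero-dimensional subschemes of $\Sigma$. $E_{i,j}$ is the $2m\times 2m$ matrix unit; $J_l$ is the $l\times l$ nilpotent Jordan block with ones on the superdiagonal; $\mathcal E_{j,k}$ is the $j\times k$ matrix with $1$ in position $(j,k)$ and zeros elsewhere. Put $$X_n=\begin{pmatrix}J_{m-n}&0&\mathcal E_{m-n,m-n}&0\\0&J_n&0&\mathcal E_{n,n}\\0&0&-J_{m-n}^{\top}&0\\0&0&0&-J_n^{\top}\end{pmatrix}.$$ Case $n<m/2$: for complex numbers $a_i,y_i,z_i$ ($1\le i\le n$), $d_j$ ($1\le j\le m-n$) let $M$ be the symmetric $m\times m$ matrix with diagonal $(d_{m-n},\dots,d_1,a_n,\dots,a_1)$, with $M_{1,m-n+i}=M_{m-n+i,1}=y_i$ ($1\le i\le n$), $M_{j+1,m}=M_{m,j+1}=z_j$ ($1\le j\le n$), other entries $0$; put $S(a_i,y_i,z_i,d_j)=X_n+\begin{pmatrix}0&0\\ M&0\end{pmatrix}$. Case $n=m/2$: let $M'$ be the symmetric $m\times m$ matrix with diagonal $(d_n,\dots,d_2,d_1+z_n^2,a_n,\dots,a_1)$, with $M'_{1,n+i}=M'_{n+i,1}=y_i$ ($1\le i\le n$), $M'_{j+1,m}=M'_{m,j+1}=z_j$ ($1\le j\le n-1$), other entries $0$; put $S(a_i,y_i,z_i,d_j)=X_n+\begin{pmatrix}0&0\\ M'&0\end{pmatrix}+z_n(E_{m,n}-E_{n+m,2m})$. $\mathcal S_n$ is the set of all $S(a_i,y_i,z_i,d_j)$ with complex parameters,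 and $\mathcal Y_{n,\tau}=\chi^{-1}(\tau)\cap\mathcal S_n$. *)

(* Defs.v *)
From HB Require Import structures.
From mathcomp Require Import all_boot all_order all_algebra.
From mathcomp Require Import all_classical all_reals topology normedtype derive.
From mathcomp Require Import complex.
From mathcomp Require Import -(notations) mpoly.
Set Implicit Arguments.
Unset Strict Implicit.
Unset Printing Implicit Defensive.
Import numFieldNormedType.Exports.
Import GRing.Theory.
Local Open Scope classical_set_scope.
Local Open Scope ring_scope.

(** * The symplectic Lie algebra and its adjoint quotient *)

Section Symplectic.
Variables (R : realType) (k : nat).
Local Notation C := R[i].

Definition sp : set 'M[C]_(k + k) :=
  [set Y | exists P Q S : 'M[C]_k,
     [/\ Q^T = Q, S^T = S & Y = block_mx P Q S (- P^T)]].

Definition symplectic_form : 'M[C]_(k + k) := block_mx 0 1%:M (- 1%:M) 0.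

Definition Sp : set 'M[C]_(k + k) :=
  [set g | g^T *m symplectic_form *m g = symplectic_form].

Definition cartan (x : 'rV[C]_k) : 'M[C]_(k + k) := diag_mx (row_mx x (- x)).

Definition semisimple_part (Y S : 'M[C]_(k + k)) : Prop :=
  [/\ diagonalizable S, comm_mx S Y & exists e, (Y - S) ^+ e = 0].

(** The graph of the adjoint quotient [sp -> h / W]: a point of
    [h / W = Sym_k(C)] is a sequence [t] of length [k] taken up to permutation,
    and the class of [cartan x] is the multiset of the squares [x_i ^+ 2]. *)
Definition adjoint_quotient (Y : 'M[C]_(k + k)) (t : seq C) : Prop :=
  sp Y /\ exists (S g : 'M[C]_(k + k)) (x : 'rV[C]_k),
    [/\ semisimple_part Y S, Sp g, S = g *m cartan x *m invmx g &
        perm_eq [seq x ord0 i ^+ 2 | i : 'I_k] t].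

End Symplectic.

(** * The slice *)

(** Matrices are indexed from 0 and [l] stands for [m - n], so that [m] appears
    as [l + n].  The parameters [a_i], [y_i], [z_i], [d_j] (indexed from 1) are
    the entries [i - 1], [j - 1] of the row vectors [a], [y], [z], [d]. *)
Section Slice.
Variables (R : realType) (l n : nat).
Local Notation C := R[i].

Definition jordan_nil j : 'M[C]_j := \matrix_(i, k) (i.+1 == k :> nat)%:R.

Definition corner j k : 'M[C]_(j, k) :=
  \matrix_(p, q) ((p.+1 == j) && (q.+1 == k))%:R.

Definition nilp_X : 'M[C]_((l + n) + (l + n)) :=
  block_mx (block_mx (jordan_nil l) 0 0 (jordan_nil n))
           (block_mx (corner l l) 0 0 (corner n n))
           0
           (block_mx (- (jordan_nil l)^T) 0 0 (- (jordan_nil n)^T)).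

(** The upper right block of [M]: [y] in its first row, and [z_j] in row
    [j + 1] of its last column.  When [n = l] its rows stop at [n], so that
    [z_n] does not occur in it, as required of [M']. *)
Definition slice_offdiag (y z : 'rV[C]_n) : 'M[C]_(l, n) :=
  \matrix_(p, q) if p == 0%N :> nat then y ord0 q
                 else \sum_(j < n | (p == j.+1 :> nat) && (q.+1 == n)) z ord0 j.

Definition slice_M (a y z : 'rV[C]_n) (d : 'rV[C]_l) : 'M[C]_(l + n) :=
  block_mx (diag_mx (\row_i d ord0 (rev_ord i))) (slice_offdiag y z)
           (slice_offdiag y z)^T (diag_mx (\row_i a ord0 (rev_ord i))).

Definition slice_lt (a y z : 'rV[C]_n) (d : 'rV[C]_l) :
    'M[C]_((l + n) + (l + n)) :=
  nilp_X + block_mx 0 0 (slice_M a y z d) 0.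

(** [z_n], for [n > 0]. *)
Definition last_entry (z : 'rV[C]_n) : C := \sum_(j < n | j.+1 == n) z ord0 j.

(** The matrix [E_{m,n} - E_{n+m,2m}] when [l = n]: in terms of blocks,
    [E_{m,n}] is the last entry of the lower left [n * l] block of [P]. *)
Definition slice_E : 'M[C]_((l + n) + (l + n)) :=
  let E := block_mx 0 0 (corner n l) 0 in block_mx E 0 0 (- E^T).

(** Only meant for [l = n]; the added corner turns [d_1] into
    [d_1 + z_n ^+ 2]. *)
Definition slice_eq (a y z : 'rV[C]_n) (d : 'rV[C]_l) :
    'M[C]_((l + n) + (l + n)) :=
  let M' := slice_M a y z d
            + block_mx (last_entry z ^+ 2 *: corner l l) 0 0 0 in
  nilp_X + block_mx 0 0 M' 0 + last_entry z *: slice_E.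

Definition slice : set 'M[C]_((l + n) + (l + n)) :=
  [set Y | exists (a y z : 'rV[C]_n) (d : 'rV[C]_l),
     Y = if (n < l)%N then slice_lt a y z d else slice_eq a y z d].

Definition slice_fiber (t : seq C) : set 'M[C]_((l + n) + (l + n)) :=
  [set Y | slice Y /\ adjoint_quotient Y t].

End Slice.

Arguments slice {R} l n.
Arguments slice_fiber {R} l n t.

(** * Reduced complex analytic structures *)

(** A reduced complex space is described by a topological space [X] and a
    predicate [hol f x] saying that the germ at [x] of [f : X -> C] is a
    section of the structure sheaf. *)

(** The germs pulled back by a local embedding [phi] of [X] in a complex normed
    space.  For [C], complex differentiability on an open set is holomorphy. *)
Definition hol_along (R : realType) (X : topologicalType)
    (E : normedModType R[i]) (phi : X -> E) (f : X -> R[i]) (x : X) : Prop :=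
  exists F : E -> R[i]^o,
    (\forall p \near phi x, differentiable F p) /\
    (\forall x' \near x, f x' = F (phi x')).

Definition hol_subset (R : realType) (E : normedModType R[i]) (A : set E)
    (f : A -> R[i]) (x : A) : Prop :=
  hol_along (set_val : A -> E) f x.

(** An isomorphism onto an open subspace, as spaces with sheaves of functions:
    [g] is holomorphic near [j x] if and only if [g \o j] is so near [x]. *)
Definition open_holomorphic_embedding (R : realType) (X Y : topologicalType)
    (holX : (X -> R[i]) -> X -> Prop) (holY : (Y -> R[i]) -> Y -> Prop)
    (j : X -> Y) : Prop :=
  [/\ injective j, continuous j, forall U : set X, open U -> open (j @` U) &
      forall (x : X) (g : Y -> R[i]), holY g (j x) <-> holX (g \o j) x].

(** * Hilbert schemes of points of a surface in C^3 *)

Section Hilbert.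
Variable R : realType.
Local Notation C := R[i].

(** The coordinate ring [C[u, v, z]] of C^3. *)
Local Notation poly3 := (mpoly 3 C).

Definition var (i : 'I_3) : poly3 := mpolyX C (mnm1 i).
Definition u_ : poly3 := var (inord 0).
Definition v_ : poly3 := var (inord 1).
Definition z_ : poly3 := var (inord 2).

(** The equation of the surface [P_t(z) + u^2 + z v^2 = 0]. *)
Definition surface_eqn (t : seq C) : poly3 :=
  \prod_(c <- t) (z_ - c *: 1) + u_ ^+ 2 + z_ * v_ ^+ 2.

Definition is_ideal (I : set poly3) : Prop :=
  [/\ I 0, forall f g, I f -> I g -> I (f + g) & forall f g, I g -> I (f * g)].

Definition lincomb n (b : 'I_n -> poly3) (c : 'rV[C]_n) : poly3 :=
  \sum_(i < n) c ord0 i *: b i.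

(** The classes of [b] form a basis of [C[u, v, z] / I]. *)
Definition quotient_basis n (b : 'I_n -> poly3) (I : set poly3) : Prop :=
  forall f, exists! c : 'rV[C]_n, I (f - lincomb b c).

(** The points of [Hilb^n] of the surface [F = 0]: the ideals of its coordinate
    ring of colength [n], seen as ideals of [C[u, v, z]] containing [F]. *)
Definition Hilb (n : nat) (F : poly3) : Type :=
  {I : set poly3 | [/\ is_ideal I, I F & exists b : 'I_n -> poly3,
                       quotient_basis b I]}.

Section HilbertSpace.
Variables (n : nat) (F : poly3).
Local Notation H := (Hilb n F).
Implicit Types (I J : H) (b : 'I_n -> poly3).

(** The affine open subscheme [U_b] where [b] is a basis of the quotient. *)
Definition in_chart b I : Prop := quotient_basis b (proj1_sig I).

Definition coords b I (f : poly3) : 'rV[C]_n :=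
  xget 0 [set c | proj1_sig I (f - lincomb b c)].

Definition mult_mx b I (f : poly3) : 'M[C]_n :=
  \matrix_(i, k) coords b I (f * b i) ord0 k.

Definition chart_space : normedModType C :=
  ('rV[C]_n * ('M[C]_n * ('M[C]_n * 'M[C]_n)))%type.

(** The closed embedding of [U_b] in an affine space: a family of quotients of
    [C[u, v, z]] with basis [b] amounts to the coordinates of [1] in [b] and the
    matrices in [b] of the multiplications by [u], [v], [z], subject to
    polynomial equations.  The scheme is smooth, hence reduced, when the surface
    is smooth; so its holomorphic functions are the local restrictions of those
    of the affine space. *)
Definition chart b I : chart_space :=
  (coords b I 1, (mult_mx b I u_, (mult_mx b I v_, mult_mx b I z_))).

(** The topology glued from the charts. *)
Definition Hilb_open (V : set H) : Prop :=
  forall b I, in_chart b I -> V I ->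
    \forall p \near chart b I, forall J, in_chart b J -> chart b J = p -> V J.

Lemma Hilb_openT : Hilb_open setT.
Proof. by move=> b I _ _; exact: filterE. Qed.

Lemma Hilb_openI : setI_closed Hilb_open.
Proof.
move=> V W oV oW b I bI [VI WI].
apply: filterS2 (oV b I bI VI) (oW b I bI WI) => p Vp Wp J bJ pJ.
by split; [exact: Vp | exact: Wp].
Qed.

Lemma Hilb_open_bigU (T : Type) (V : T -> set H) :
  (forall t, Hilb_open (V t)) -> Hilb_open (\bigcup_t V t).
Proof.
move=> oV b I bI [t _ VI]; apply: filterS (oV t b I bI VI) => p Vp J bJ pJ.
by exists t => //; exact: Vp.
Qed.

HB.instance Definition _ := gen_eqMixin H.
HB.instance Definition _ := gen_choiceMixin H.
HB.instance Definition _ :=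
  isOpenTopological.Build H Hilb_openT Hilb_openI Hilb_open_bigU.

Definition hol_Hilb (g : H -> C) (I : H) : Prop :=
  exists2 b, in_chart b I & hol_along (chart b) g I.

End HilbertSpace.
End Hilbert.

(* Main.v *)
Require Import Defs.
From mathcomp Require Import all_boot all_order all_algebra.
From mathcomp Require Import all_classical all_reals topology normedtype derive.
From mathcomp Require Import complex ring.
From mathcomp Require Import -(notations) mpoly.

(** Put [l = m - n].  A vector killed by [x - Y], with [Y] in the slice, can be
    computed row by row along the two Jordan chains, of lengths [2 l] and
    [2 n]: all its entries depend linearly on the first entry of each chain,
    and two equations are left, with matrix
<<
    ( D(x^2)   B(x)   )
    ( B(-x)    A(x^2) )
>>
    up to signs.  Here [A] and [D] are monic of degrees [n] and [l], with the
    [a_i] and the [d_j], up to sign, as lower coefficients (except that [z_n]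
    shifts [d_1] when [l = n]), and [B] is a polynomial of degree less than
    [2 n] with the [y_i] and, up to sign, the [z_i] as coefficients
    ([slice_shape_eigenvalue], [char_a_horner], [char_d_horner],
    [char_b_horner]).  Hence the slice is the
    space of all such triples [(A, D, B)].

    Since the [tau_k] are distinct and nonzero, the [2 m] square roots of the
    [tau_k] are distinct.  If all of them are eigenvalues of [Y], then the
    eigenvectors form a basis, in which the symplectic form only pairs the
    eigenvectors for [x] and [- x]; after rescaling it is a symplectic basis.
    So [Y] lies over [tau] if and only if these numbers are eigenvalues
    ([adjoint_quotient_eigenvector], [eigenvectors_adjoint_quotient]).  Writing
    [B(x) = B_0(x^2) + x B_1(x^2)], this is an equality of values at the [m]
    points [tau_k], between monic polynomials of degree [m], so that the fiber
    is given by the polynomial equation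
<<
    A(z) D(z) = P(z) + U(z)^2 + z V(z)^2
>>
    where [U] and [V] are [B_0] and [B_1] times powers of the imaginary unit
    ([fiber_polys]).

    As [D] is the quotient of the right side by [A], the fiber is the space of
    triples [(A, U, V)] with [A] monic of degree [n], with [U] and [V] of degree
    less than [n], and with [A] dividing [P + U^2 + z V^2].  Such a triple is the
    subscheme [A(z) = 0], [u = U(z)], [v = V(z)] of the surface, and these are
    exactly the subschemes of length [n] whose coordinate ring has the basis
    [1, z, ..., z^(n-1)] ([graph_quotient_basis], [ideal_of_chart]).  They form
    one of the charts of the Hilbert scheme.

    The coordinates in this chart are the remainders modulo [A] of [1] and of
    the [U z^i], [V z^i], [z^(i+1)], which are polynomial in the entries of [Y];
    conversely [A], [U], [V], then the quotient [D], and finally [Y] are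
    polynomial in these coordinates.  The transition maps between charts are
    rational ([chart_transition]), so the charts are open and compatible, and it
    is enough to look at this one ([chart_embedding], [graph_embedding]). *)

Set Implicit Arguments.
Unset Strict Implicit.
Unset Printing Implicit Defensive.
Import numFieldNormedType.Exports.
Import Order.TTheory GRing.Theory Num.Theory.
Local Open Scope classical_set_scope.
Local Open Scope ring_scope.

(** * Polynomials of bounded degree *)

Section MonicDecomposition.
Variables (K : fieldType) (k : nat).

Definition monic_of (v : 'rV[K]_k) : {poly K} := 'X^k + rVpoly v.

Lemma size_monic_of v : size (monic_of v) = k.+1.
Proof. by rewrite size_polyDl size_polyXn // ltnS size_poly. Qed.

Lemma monic_of_monic v : monic_of v \is monic.
Proof. by rewrite monicE lead_coefDl ?lead_coefXn // size_polyXn ltnS size_poly. Qed.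

Lemma coef_monic_of v (i : 'I_k) : (monic_of v)`_i = v 0 i.
Proof. by rewrite coefD coefXn (ltn_eqF (ltn_ord i)) add0r coef_rVpoly_ord. Qed.

Lemma size_monicB (p q : {poly K}) : p \is monic -> q \is monic ->
  size p = k.+1 -> size q = k.+1 -> (size (p - q)%R <= k)%N.
Proof.
move=> monp monq szp szq; apply/leq_sizeP => i; rewrite coefB leq_eqVlt.
case/predU1P=> [<-|lt_ki]; last by rewrite !nth_default ?subrr ?szp ?szq.
have := monicP monp; have := monicP monq; rewrite !lead_coefE szp szq /= => -> ->.
exact: subrr.
Qed.

Lemma monic_ofK (p : {poly K}) : p \is monic -> size p = k.+1 ->
  monic_of (\row_i p`_i) = p.
Proof.
move=> monp szp; have szX : size ('X^k : {poly K}) = k.+1 by rewrite size_polyXn.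
rewrite -[RHS](subrK 'X^k) addrC /monic_of; congr (_ + _).
rewrite -[RHS](poly_rV_K (size_monicB monp (monicXn _ _) szp szX)).
congr rVpoly; apply/rowP => i; rewrite !mxE coefB coefXn.
by rewrite (ltn_eqF (ltn_ord i)) subr0.
Qed.

Lemma rVpoly_sum (c : 'rV[K]_k) : rVpoly c = \sum_(i < k) c 0 i *: 'X^i.
Proof.
apply/polyP => j; rewrite coef_sum coef_rVpoly.
case: insubP => [i lt_in <-|nlt_jk].
  rewrite (bigD1 i) //= coefZ coefXn eqxx mulr1 big1 ?addr0 // => j' ne_j'.
  rewrite coefZ coefXn -(inj_eq val_inj) /= eq_sym in ne_j' *.
  by rewrite (negPf ne_j') mulr0.
rewrite big1 // => j' _; rewrite coefZ coefXn; case: eqP => [eq_j|_]; last first.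
  by rewrite mulr0.
by rewrite eq_j ltn_ord in nlt_jk.
Qed.

Lemma horner_rVpoly (v : 'rV[K]_k) x : (rVpoly v).[x] = \sum_(i < k) v 0 i * x ^+ i.
Proof.
rewrite horner_poly; apply: eq_bigr => i _; by rewrite valK.
Qed.

Lemma horner_monic_of v x : (monic_of v).[x] = x ^+ k + \sum_(i < k) v 0 i * x ^+ i.
Proof. by rewrite hornerD hornerXn horner_rVpoly. Qed.

End MonicDecomposition.

Section EvenOdd.
Variable K : nzRingType.
Implicit Types p q : {poly K}.

Definition even_odd p q := (p \Po 'X^2) + (q \Po 'X^2) * 'X.

Lemma coef_even_odd p q i : (even_odd p q)`_i = if odd i then q`_i./2 else p`_i./2.
Proof.
rewrite coefD coefMX !coef_comp_poly_Xn // !dvdn2 !divn2.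
case: i => [|i] /=; first by rewrite addr0.
rewrite negbK uphalf_half; case: (boolP (odd i)) => oi /=; first by rewrite addr0.
by rewrite add0r add0n.
Qed.

Lemma even_poly_even_odd p q : even_poly (even_odd p q) = p.
Proof. by apply/polyP => i; rewrite coef_even_poly coef_even_odd odd_double doubleK. Qed.

Lemma odd_poly_even_odd p q : odd_poly (even_odd p q) = q.
Proof.
apply/polyP => i; rewrite coef_odd_poly coef_even_odd /= odd_double /=.
by rewrite uphalf_double.
Qed.

Lemma size_even_odd p q k : (size p <= k)%N -> (size q <= k)%N ->
  (size (even_odd p q) <= k + k)%N.
Proof.
move=> szp szq; apply/leq_sizeP => i; rewrite addnn -geq_half_double => le_ki.
rewrite coef_even_odd; case: ifP => _; apply: nth_default; exact: leq_trans le_ki.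
Qed.

End EvenOdd.

(** * Differentiable families of matrices and polynomials *)

Lemma differentiable_fst (K : numFieldType) (V W : normedModType K) (x : V * W) :
  differentiable (fst : V * W -> V) x.
Proof. by apply: linear_differentiable => ?; exact: cvg_fst. Qed.

Lemma differentiable_snd (K : numFieldType) (V W : normedModType K) (x : V * W) :
  differentiable (snd : V * W -> W) x.
Proof. by apply: linear_differentiable => ?; exact: cvg_snd. Qed.

Section Differentiable.
Variables (K : numFieldType) (E : normedModType K) (x : E).

Lemma differentiable_bigsum (I : Type) (r : seq I) (P : pred I)
    (f : I -> E -> K) :
  (forall i, differentiable (f i) x) ->
  differentiable (fun p => \sum_(i <- r | P i) f i p) x.
Proof.
move=> df; elim: r => [|i r IH].
  by under eq_fun do rewrite big_nil; exact: differentiable_cst.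
under eq_fun do rewrite big_cons; case: (P i) => //.
exact: (differentiableD (df i) IH).
Qed.

Lemma differentiable_bigprod (I : Type) (r : seq I) (P : pred I)
    (f : I -> E -> K) :
  (forall i, differentiable (f i) x) ->
  differentiable (fun p => \prod_(i <- r | P i) f i p) x.
Proof.
move=> df; elim: r => [|i r IH].
  by under eq_fun do rewrite big_nil; exact: differentiable_cst.
under eq_fun do rewrite big_cons; case: (P i) => //.
exact: (differentiableM (df i) IH).
Qed.

Lemma differentiable_mulf (f g : E -> K) :
  differentiable f x -> differentiable g x ->
  differentiable (fun p => f p * g p) x.
Proof. exact: differentiableM. Qed.

Lemma differentiable_addf (f g : E -> K) :
  differentiable f x -> differentiable g x ->
  differentiable (fun p => f p + g p) x.
Proof. exact: differentiableD. Qed.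

Lemma differentiable_oppf (f : E -> K) :
  differentiable f x -> differentiable (fun p => - f p) x.
Proof. exact: differentiableN. Qed.

Lemma differentiable_mxP m n (F : E -> 'M[K]_(m, n)) :
  differentiable F x <-> forall i j, differentiable (fun p => F p i j) x.
Proof.
split=> [dF i j|dF].
  exact: (differentiable_comp dF (differentiable_coord _ _ _)).
have -> : F = \sum_i \sum_j (fun p => F p i j *: delta_mx i j).
  apply/funext => p; rewrite fct_sumE [LHS]matrix_sum_delta.
  by apply: eq_bigr => i _; rewrite fct_sumE.
apply: differentiable_sum => i; apply: differentiable_sum => j.
exact: differentiableZl.
Qed.

Lemma differentiable_mulmx m n k (F : E -> 'M[K]_(m, n)) (G : E -> 'M[K]_(n, k)) :
  differentiable F x -> differentiable G x ->
  differentiable (fun p => F p *m G p) x.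
Proof.
move=> /differentiable_mxP dF /differentiable_mxP dG.
apply/differentiable_mxP => i j; under eq_fun do rewrite mxE.
by apply: differentiable_bigsum => l; exact: differentiable_mulf.
Qed.

Lemma differentiable_det n (F : E -> 'M[K]_n) :
  differentiable F x -> differentiable (fun p => \det (F p)) x.
Proof.
move=> /differentiable_mxP dF; apply: differentiable_bigsum => s.
by apply: differentiable_mulf => //; exact: differentiable_bigprod.
Qed.

Lemma differentiable_adj n (F : E -> 'M[K]_n) :
  differentiable F x -> differentiable (fun p => \adj (F p)) x.
Proof.
move=> /differentiable_mxP dF; apply/differentiable_mxP => i j.
under eq_fun do rewrite mxE.
apply: differentiable_mulf => //; apply: differentiable_det.
by apply/differentiable_mxP => k l; under eq_fun do rewrite !mxE.
Qed.

End Differentiable.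

(** A single rational expression on all matrices, hence differentiable wherever
    the determinant is not 0; [invmx] is defined by cases. *)
Definition adj_inv (K : fieldType) n (T : 'M[K]_n) : 'M[K]_n :=
  (\det T)^-1 *: \adj T.

Lemma mulmx_adj_inv (K : fieldType) n (T : 'M[K]_n) :
  T \in unitmx -> T *m adj_inv T = 1%:M.
Proof.
move=> uT; rewrite -scalemxAr mul_mx_adj scale_scalar_mx mulVf //.
by rewrite -unitfE -unitmxE.
Qed.

Lemma differentiable_adj_inv (K : numFieldType) (E : normedModType K) (x : E) n
    (F : E -> 'M[K]_n) :
  differentiable F x -> F x \in unitmx ->
  differentiable (fun p => adj_inv (F p)) x.
Proof.
move=> dF uF; apply/differentiable_mxP => i j; under eq_fun do rewrite mxE.
apply: differentiable_mulf; last first.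
  by move: i j; apply/differentiable_mxP; exact: differentiable_adj.
apply: differentiableV; first exact: differentiable_det.
by rewrite -unitfE -unitmxE.
Qed.

Lemma near_unitmx (K : numFieldType) (E : normedModType K) (x : E) n
    (F : E -> 'M[K]_n) :
  differentiable F x -> F x \in unitmx -> \forall p \near x, F p \in unitmx.
Proof.
move=> dF uF; have neq0 : \det (F x) != 0 by rewrite -unitfE -unitmxE.
have cdet := differentiable_continuous (differentiable_det dF).
apply: filterS (cvgr_neq0 _ cdet neq0) => p.
by rewrite unitmxE unitfE.
Qed.

Section DifferentiablePoly.
Variables (K : numFieldType) (E : normedModType K) (x : E).
Implicit Types F G : E -> {poly K}.

Definition differentiable_poly F := forall i, differentiable (fun p => (F p)`_i) x.

Lemma differentiable_polyD F G : differentiable_poly F -> differentiable_poly G ->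
  differentiable_poly (fun p => F p + G p).
Proof.
move=> dF dG i; under eq_fun do rewrite coefD.
exact: differentiable_addf.
Qed.

Lemma differentiable_polyN F : differentiable_poly F ->
  differentiable_poly (fun p => - F p).
Proof.
by move=> dF i; under eq_fun do rewrite coefN; exact: differentiable_oppf.
Qed.

Lemma differentiable_polyM F G : differentiable_poly F -> differentiable_poly G ->
  differentiable_poly (fun p => F p * G p).
Proof.
move=> dF dG i; under eq_fun do rewrite coefM.
by apply: differentiable_bigsum => j; exact: differentiable_mulf.
Qed.

Lemma differentiable_polyC (P : {poly K}) : differentiable_poly (fun=> P).
Proof. by move=> i; exact: differentiable_cst. Qed.

(** Dividing by a monic polynomial of fixed degree only involves sums and
    products of the coefficients. *)
Lemma differentiable_poly_divp n k F G :
    (forall p, G p \is monic) -> (forall p, size (G p) = n.+1) ->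
    (forall p, (size (F p) <= n + k)%N) ->
    differentiable_poly F -> differentiable_poly G ->
  differentiable_poly (fun p => F p %/ G p).
Proof.
move=> monG szG; elim: k F => [|k IH] F szF dF dG.
  have -> : (fun p => F p %/ G p) = fun=> 0.
    by apply/funext => p; rewrite divp_small // szG ltnS -[n]addn0.
  exact: differentiable_polyC.
(* The leading term of the quotient: removing its product with [G p] lowers the
   bound on the degree by 1. *)
pose c p := (F p)`_(n + k) *: 'X^k : {poly K}.
have dc : differentiable_poly c.
  move=> i; under eq_fun do rewrite /c coefZ.
  by apply: differentiable_mulf; [exact: dF | exact: differentiable_cst].
have -> : (fun p => F p %/ G p) = fun p => c p + (F p - c p * G p) %/ G p.
  apply/funext => p; rewrite divpD divpN mulpK ?monic_neq0 //.
  by rewrite addrC subrK.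
apply: differentiable_polyD => //; apply: IH => //; last first.
  apply: differentiable_polyD => //; apply: differentiable_polyN.
  exact: differentiable_polyM.
move=> p; apply/leq_sizeP => i; rewrite leq_eqVlt => /predU1P[<-|lt_i].
  rewrite coefB /c -scalerAl coefZ coefXnM ifF ?addnK; last first.
    by rewrite ltnNge leq_addl.
  have := monicP (monG p); rewrite /lead_coef szG /= => ->.
  by rewrite mulr1 subrr.
rewrite coefB /c -scalerAl coefZ coefXnM.
rewrite nth_default ?(leq_trans (szF p)) ?addnS // sub0r.
case: ltnP => [_|le_ki]; first by rewrite mulr0 oppr0.
by rewrite [(G p)`__]nth_default ?mulr0 ?oppr0 // szG ltn_subRL addnC.
Qed.

Lemma differentiable_poly_modp n k F G :
    (forall p, G p \is monic) -> (forall p, size (G p) = n.+1) ->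
    (forall p, (size (F p) <= n + k)%N) ->
    differentiable_poly F -> differentiable_poly G ->
  differentiable_poly (fun p => F p %% G p).
Proof.
move=> monG szG szF dF dG.
have -> : (fun p => F p %% G p) = fun p => F p + - (F p %/ G p * G p).
  by apply/funext => p; rewrite {2}(divp_eq (F p) (G p)) addrC addKr.
apply: differentiable_polyD => //; apply: differentiable_polyN.
apply: differentiable_polyM => //.
exact: differentiable_poly_divp szG szF dF dG.
Qed.

Lemma differentiable_rVpoly n (v : E -> 'rV[K]_n) :
  differentiable v x -> differentiable_poly (fun p => rVpoly (v p)).
Proof.
move=> /differentiable_mxP dv k; under eq_fun do rewrite coef_rVpoly.
by case: insub => [i|]; [exact: dv | exact: differentiable_cst].
Qed.

End DifferentiablePoly.

Lemma differentiable_block_mx (K : numFieldType) (E : normedModType K) (x : E)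
    m1 m2 n1 n2 (A : E -> 'M[K]_(m1, n1)) (B : E -> 'M[K]_(m1, n2))
    (C : E -> 'M[K]_(m2, n1)) (D : E -> 'M[K]_(m2, n2)) :
  differentiable A x -> differentiable B x -> differentiable C x ->
  differentiable D x -> differentiable (fun p => block_mx (A p) (B p) (C p) (D p)) x.
Proof.
move=> /differentiable_mxP dA /differentiable_mxP dB /differentiable_mxP dC.
move=> /differentiable_mxP dD; apply/differentiable_mxP => i j.
by case: (split_ordP i) => i' ->; case: (split_ordP j) => j' ->;
  [under eq_fun do rewrite block_mxEul | under eq_fun do rewrite block_mxEur |
   under eq_fun do rewrite block_mxEdl | under eq_fun do rewrite block_mxEdr].
Qed.

(** The entry at two natural numbers, which avoids ordinals of types ['I_l] and
    ['I_n] where [l] and [n] are not successors. *)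
Definition entry (K : nmodType) p q (M : 'M[K]_(p, q)) (i j : nat) : K :=
  if insub i is Some i' then if insub j is Some j' then M i' j' else 0 else 0.

Lemma entryE (K : nmodType) p q (M : 'M[K]_(p, q)) i j
    (lt_ip : (i < p)%N) (lt_jq : (j < q)%N) :
  entry M i j = M (Ordinal lt_ip) (Ordinal lt_jq).
Proof. by rewrite /entry !insubT. Qed.

Lemma differentiable_entry (K : numFieldType) (E : normedModType K) (x : E) p q
    (M : E -> 'M[K]_(p, q)) i j :
  differentiable M x -> differentiable (fun y => entry (M y) i j) x.
Proof.
move=> /differentiable_mxP dM; rewrite /entry.
by case: insub => [i'|]; [case: insub => [j'|]|]; [exact: dM|exact: differentiable_cst..].
Qed.

Lemma near_comp (K : numFieldType) (V W : normedModType K) (f : V -> W) p (P : set W) :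
  differentiable f p -> (\forall q \near f p, P q) -> \forall q \near p, P (f q).
Proof. by move=> /differentiable_continuous; apply. Qed.

(** * Charts of the Hilbert scheme *)

Lemma poly3_ind (R : realType) (P : mpoly 3 R[i] -> Prop) :
    (forall c, P c%:A) -> P (u_ R) -> P (v_ R) -> P (z_ R) ->
    (forall f g, P f -> P g -> P (f + g)) ->
    (forall f g, P f -> P g -> P (f * g)) ->
  forall f, P f.
Proof.
move=> PC Pu Pv Pz PD PM f.
have Pvar i : P (var R i).
  have [||] : [\/ i = inord 0, i = inord 1 | i = inord 2].
  - case: i => -[|[|[|//]]] lti; [constructor 1|constructor 2|constructor 3];
      by apply: val_inj; rewrite /= inordK.
  - by move->; exact: Pu.
  - by move->; exact: Pv.
  - by move->; exact: Pz.
have PX (x : mpoly 3 R[i]) k : P x -> P (x ^+ k).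
  move=> Px; elim: k => [|k IH]; last by rewrite exprS; exact: PM.
  by rewrite expr0 -(scale1r 1); exact: PC.
elim/mpolyind: f => [|c m f _ _ Pf]; first by rewrite -(scale0r 1); exact: PC.
apply: PD => //; rewrite -mulr_algl; apply: (PM) => //.
rewrite mpolyXE_id; apply: (big_ind P) => //.
  by rewrite -(scale1r 1); exact: PC.
by move=> i _; exact: PX (Pvar i).
Qed.

Section Charts.
Variables (R : realType) (n : nat) (F : mpoly 3 R[i]).
Local Notation C := R[i].
Local Notation H := (Hilb n F).
Local Notation poly3 := (mpoly 3 C).
Implicit Types (I J : H) (b : 'I_n -> poly3) (f g : poly3).

Lemma Hilb_inj I J : proj1_sig I = proj1_sig J -> I = J.
Proof.
case: I J => [I hI] [J hJ] /= eq_IJ; rewrite -{J}eq_IJ in hJ *.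
by congr exist; exact: Prop_irrelevance.
Qed.

Section Ideal.
Variable I : H.
Local Notation "f '\inI'" := (proj1_sig I f) (at level 70).

Lemma Hilb_ideal0 : 0 \inI.
Proof. by case: (proj2_sig I) => -[]. Qed.

Lemma Hilb_idealD f g : f \inI -> g \inI -> f + g \inI.
Proof. by case: (proj2_sig I) => -[_ + _] _ _; apply. Qed.

Lemma Hilb_idealM f g : g \inI -> f * g \inI.
Proof. by case: (proj2_sig I) => -[_ _ +] _ _; apply. Qed.

Lemma Hilb_ideal_eqn : F \inI.
Proof. by case: (proj2_sig I). Qed.

Lemma Hilb_idealMr f g : g \inI -> g * f \inI.
Proof. by rewrite mulrC; exact: Hilb_idealM. Qed.

Lemma Hilb_idealZ c f : f \inI -> c *: f \inI.
Proof. by move=> If; rewrite -mulr_algl; exact: Hilb_idealM. Qed.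

Lemma Hilb_idealB f g : f \inI -> g \inI -> f - g \inI.
Proof.
by move=> If Ig; rewrite -scaleN1r; apply: Hilb_idealD; last exact: Hilb_idealZ.
Qed.

Lemma Hilb_ideal_trans f g h : f - g \inI -> g - h \inI -> f - h \inI.
Proof. by move=> fg gh; rewrite -(subrK g f) -addrA; exact: Hilb_idealD. Qed.

Variable b : 'I_n -> poly3.
Hypothesis bI : in_chart b I.

Lemma coordsP f : f - lincomb b (coords b I f) \inI.
Proof.
have [c [Ic _]] := bI f.
by rewrite /coords; case: xgetP => [c' -> //|/(_ c)].
Qed.

Lemma coords_unique f c : f - lincomb b c \inI -> coords b I f = c.
Proof.
move=> fc; have [c' [_ uc]] := bI f.
by rewrite -(uc _ fc) -(uc _ (coordsP f)).
Qed.

Lemma lincombD c c' : lincomb b (c + c') = lincomb b c + lincomb b c'.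
Proof.
by rewrite -big_split; apply: eq_bigr => i _; rewrite mxE scalerDl.
Qed.

Lemma lincombZ a c : lincomb b (a *: c) = a *: lincomb b c.
Proof.
by rewrite scaler_sumr; apply: eq_bigr => i _; rewrite mxE scalerA.
Qed.

Lemma coordsD f g : coords b I (f + g) = coords b I f + coords b I g.
Proof.
apply: coords_unique; rewrite lincombD opprD addrACA.
by apply: Hilb_idealD; exact: coordsP.
Qed.

Lemma coordsZ c f : coords b I (c *: f) = c *: coords b I f.
Proof.
by apply: coords_unique; rewrite lincombZ -scalerBr; apply: Hilb_idealZ (coordsP f).
Qed.

Lemma coords_congr f g : f - g \inI -> coords b I f = coords b I g.
Proof. by move=> fg; apply: coords_unique; exact: Hilb_ideal_trans (coordsP g). Qed.

Lemma coords_lincomb c : coords b I (lincomb b c) = c.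
Proof. by apply: coords_unique; rewrite subrr; exact: Hilb_ideal0. Qed.

Lemma coords_eq0 f : coords b I f = 0 <-> f \inI.
Proof.
have lin0 : lincomb b 0 = 0.
  by apply: big1 => i _; rewrite mxE scale0r.
split=> [f0|If]; first by have := coordsP f; rewrite f0 lin0 subr0.
by apply: coords_unique; rewrite lin0 subr0.
Qed.

Lemma coords_sum (r : seq 'I_n) (f : 'I_n -> poly3) :
  coords b I (\sum_(i <- r) f i) = \sum_(i <- r) coords b I (f i).
Proof.
elim: r => [|i r IH]; last by rewrite !big_cons coordsD IH.
by rewrite !big_nil; apply/coords_eq0; exact: Hilb_ideal0.
Qed.

Lemma row_mult_mx f i : row i (mult_mx b I f) = coords b I (f * b i).
Proof. by apply/rowP => k; rewrite !mxE. Qed.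

(** Coordinates are row vectors, so that multiplication matrices act on the
    right. *)
Lemma coordsM f g : coords b I (f * g) = coords b I g *m mult_mx b I f.
Proof.
have -> : coords b I (f * g) = coords b I (f * lincomb b (coords b I g)).
  by apply: coords_congr; rewrite -mulrBr; apply: Hilb_idealM; exact: coordsP.
rewrite mulr_sumr coords_sum mulmx_sum_row; apply: eq_bigr => i _.
by rewrite -scalerAr coordsZ row_mult_mx.
Qed.

Lemma mult_mxD f g : mult_mx b I (f + g) = mult_mx b I f + mult_mx b I g.
Proof.
by apply/matrixP => i k; rewrite !mxE mulrDl coordsD mxE.
Qed.

Lemma mult_mxM f g : mult_mx b I (f * g) = mult_mx b I g *m mult_mx b I f.
Proof.
apply/row_matrixP => i; rewrite row_mul !row_mult_mx.
by rewrite -mulrA coordsM.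
Qed.

Lemma mult_mxC c : mult_mx b I c%:A = c%:M.
Proof.
apply/row_matrixP => i; rewrite row_mult_mx mulr_algl coordsZ -scalemx1 linearZ /=.
congr (_ *: _); apply: coords_unique; rewrite (_ : lincomb _ _ = b i) ?subrr.
  exact: Hilb_ideal0.
rewrite /lincomb (bigD1 i) //= big1 => [|j ne_ji]; rewrite !mxE ?eqxx.
  by rewrite scale1r addr0.
by rewrite eq_sym (negPf ne_ji) scale0r.
Qed.

End Ideal.

(** The matrices of [u], [v], [z] belong to the coordinates of the chart; sums
    and products of polynomials become sums and products of matrices. *)
Lemma mult_mx_regular b f : exists M : chart_space R n -> 'M[C]_n,
  (forall p, differentiable M p) /\
  forall I, in_chart b I -> mult_mx b I f = M (chart b I).
Proof.
elim/poly3_ind: f => [c||||f g [M [dM eM]] [N [dN eN]]|f g [M [dM eM]] [N [dN eN]]].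
- exists (fun=> c%:M); split=> [p|I bI]; first exact: differentiable_cst.
  exact: mult_mxC.
- by exists (fun p => p.2.1); split=> // p; exact: (differentiable_comp
    (differentiable_snd _) (differentiable_fst _)).
- exists (fun p => p.2.2.1); split=> // p; exact: (differentiable_comp
    (differentiable_comp (differentiable_snd _) (differentiable_snd _))
    (differentiable_fst _)).
- exists (fun p => p.2.2.2); split=> // p; exact: (differentiable_comp
    (differentiable_comp (differentiable_snd _) (differentiable_snd _))
    (differentiable_snd _)).
- exists (fun p => M p + N p); split=> [p|I bI]; first exact: differentiableD.
  by rewrite mult_mxD // eM // eN.
- exists (fun p => N p *m M p); split=> [p|I bI]; first exact: differentiable_mulmx.
  by rewrite mult_mxM // eM // eN.
Qed.

(** The vectors [b' i] have coordinates in [b] which are polynomial in the point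
    of the chart of [b].  They form a basis where the determinant of these
    coordinates does not vanish, and passing from one basis to the other
    conjugates the multiplication matrices. *)
Lemma chart_transition b b' I : in_chart b I -> in_chart b' I ->
  exists Phi : chart_space R n -> chart_space R n,
    (\forall p \near chart b I, differentiable Phi p) /\
    (\forall p \near chart b I, forall J, in_chart b J -> chart b J = p ->
       in_chart b' J /\ chart b' J = Phi p).
Proof.
move=> bI b'I.
have [M M_prop] := boolp.choice (fun i => mult_mx_regular b (b' i)).
(* The change of basis: its rows are the coordinates in [b] of the [b' i]. *)
pose T (p : chart_space R n) := \matrix_i (p.1 *m M i p).
have dT p : differentiable T p.
  apply/differentiable_mxP => i k; under eq_fun do rewrite mxE.
  suff /differentiable_mxP : differentiable (fun q => q.1 *m M i q) p by [].
  apply: differentiable_mulmx; first exact: differentiable_fst.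
  exact: (M_prop i).1.
have rowT J i : in_chart b J -> row i (T (chart b J)) = coords b J (b' i).
  move=> bJ; rewrite rowK /= -(M_prop i).2 //.
  by rewrite -coordsM // mulr1.
have coordsT J c : in_chart b J -> coords b J (lincomb b' c) = c *m T (chart b J).
  move=> bJ; rewrite coords_sum // mulmx_sum_row; apply: eq_bigr => i _.
  by rewrite coordsZ // rowT.
have unitT J : in_chart b J -> in_chart b' J <-> T (chart b J) \in unitmx.
  move=> bJ; split=> [b'J|uT f].
    rewrite -row_free_unit; apply/inj_row_free => c; rewrite -coordsT // coords_eq0 //.
    by move=> /(coords_eq0 b'J); rewrite coords_lincomb.
  exists (coords b J f *m invmx (T (chart b J))); split.
    apply/(coords_eq0 bJ); rewrite -scaleN1r coordsD // coordsZ // coordsT //.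
    by rewrite mulmxKV // scaleN1r subrr.
  move=> c /(coords_congr bJ) ->.
  by rewrite coordsT // mulmxK.
pose S p := adj_inv (T p).
exists (fun p => (p.1 *m S p, (T p *m p.2.1 *m S p, (T p *m p.2.2.1 *m S p,
   T p *m p.2.2.2 *m S p)))).
have unear := near_unitmx (dT _) ((unitT I bI).1 b'I).
split.
  apply: filterS unear => p uT; have dS : differentiable S p.
    exact: differentiable_adj_inv.
  have d2 := differentiable_snd p.
  have d22 := differentiable_comp d2 (differentiable_snd p.2).
  do ![apply: differentiable_pair]; do ?[apply: differentiable_mulmx] => //.
  - exact: differentiable_fst.
  - exact: (differentiable_comp d2 (differentiable_fst _)).
  - exact: (differentiable_comp d22 (differentiable_fst _)).
  - exact: (differentiable_comp d22 (differentiable_snd _)).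
apply: filterS unear => p uT J bJ def_p; rewrite -{p}def_p in uT *.
have b'J : in_chart b' J by apply/(unitT J bJ).
have toT f : coords b' J f = coords b J f *m S (chart b J).
  apply: (coords_unique b'J); apply/(coords_eq0 bJ).
  rewrite -scaleN1r coordsD // coordsZ // coordsT // -mulmxA.
  have /mulmx1C -> := mulmx_adj_inv uT.
  by rewrite mulmx1 scaleN1r subrr.
have multT f : mult_mx b' J f = T (chart b J) *m mult_mx b J f *m S (chart b J).
  apply/row_matrixP => i; rewrite row_mult_mx toT coordsM // !row_mul rowT //.
by split=> //; rewrite /chart /= !multT toT.
Qed.

Lemma Hilb_openE (V : set H) : open V = Hilb_open V.
Proof. by []. Qed.

(** The charts are continuous, with open domains: seen from another chart [b'],
    the conditions on the chart [b] are conditions on the image of a transition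
    map, which is defined on an open set and continuous there. *)
Lemma near_chart b I (P : set (chart_space R n)) : in_chart b I ->
  (\forall p \near chart b I, P p) ->
  \forall J \near I, in_chart b J /\ P (chart b J).
Proof.
move=> bI nP; have : nbhs (chart b I) P by apply: filterS nP.
rewrite nbhsE => -[O [oO OI] OP].
have: open_nbhs I [set J | in_chart b J /\ O (chart b J)].
  split; last by split.
  rewrite Hilb_openE => b' J b'J [bJ OJ].
  have [Phi [dPhi PhiP]] := chart_transition b'J bJ.
  have cPhi := differentiable_continuous (nbhs_singleton dPhi).
  have PhiJ : Phi (chart b' J) = chart b J.
    by have [] := nbhs_singleton PhiP J b'J erefl.
  have /cPhi : \forall q \near Phi (chart b' J), O q.
    by apply: open_nbhs_nbhs; rewrite PhiJ.
  apply: filterS2 PhiP => p Phip Op J' b'J' pJ'.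
  by have [bJ' E] := Phip J' b'J' pJ'; split=> //=; rewrite E.
move=> /open_nbhs_nbhs; apply: filterS => J [bJ OJ].
by split=> //; exact: OP.
Qed.

End Charts.

(** * Embeddings described in one chart *)

Section Embedding.
Variables (R : realType) (n : nat) (F : mpoly 3 R[i]).
Variables (E : normedModType R[i]) (A : set E).
Local Notation H := (Hilb n F).

Lemma near_subset (x : A) (P : set E) :
  (\forall p \near set_val x, P p) -> \forall x' \near x, P (set_val x').
Proof. exact: (@initial_continuous _ _ (set_val : A -> E)). Qed.

Lemma nbhs_subset (x : A) (U : set A) : nbhs x U ->
  \forall p \near set_val x, forall x' : A, set_val x' = p -> U x'.
Proof.
case=> _ [[O oO <-] Ox OU]; have := open_nbhs_nbhs (conj oO Ox).
by apply: filterS => p Op x' def_p; apply: OU; rewrite /= def_p.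
Qed.

Variables (b : 'I_n -> mpoly 3 R[i]) (j : A -> H).
Variables (Theta : E -> chart_space R n) (Psi : chart_space R n -> E).
Hypotheses (dTheta : forall p, differentiable Theta p)
           (dPsi : forall p, differentiable Psi p)
           (bj : forall x, in_chart b (j x))
           (chart_j : forall x, chart b (j x) = Theta (set_val x))
           (ThetaK : forall x : A, Psi (Theta (set_val x)) = set_val x)
           (j_onto : forall J, in_chart b J -> exists x, j x = J).

Let cTheta p P := @near_comp _ _ _ Theta p P (dTheta p).
Let cPsi p P := @near_comp _ _ _ Psi p P (dPsi p).

Lemma chart_embedding_cts : continuous j.
Proof.
move=> x V; rewrite {1}nbhsE => -[O [oO Ojx] OV].
rewrite Hilb_openE in oO; have := oO b (j x) (bj x) Ojx; rewrite chart_j.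
move=> /cTheta nearO; apply: filterS (near_subset nearO) => x' Ox'.
exact/OV/(Ox' _ (bj _) (chart_j _)).
Qed.

Lemma chart_embedding_near (x : A) (U : set A) : nbhs x U -> nbhs (j x) (j @` U).
Proof.
move=> /nbhs_subset; rewrite -{1}(ThetaK x) -chart_j => /cPsi nearU.
apply: filterS (near_chart (bj x) nearU) => J [bJ UJ].
have [x' def_J] := j_onto bJ; exists x' => //; apply: UJ.
by rewrite -def_J chart_j ThetaK.
Qed.

(** When [j] is described in one chart by maps [Theta] and [Psi] between the
    ambient spaces, inverse to each other on the image of [A], the map [j] is
    open because [Psi] is continuous.  A germ extended to the ambient space of
    the chart is pulled back by [Theta], after a transition map if it comes from
    another chart; a germ extended to [E] is pulled back by [Psi]. *)
Lemma chart_embedding :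
  open_holomorphic_embedding (@hol_subset R E A) (@hol_Hilb R n F) j.
Proof.
split.
- move=> x y eq_j; apply: val_inj.
  by rewrite -[LHS]ThetaK -[RHS]ThetaK -!chart_j eq_j.
- exact: chart_embedding_cts.
- move=> U; rewrite openE => oU; rewrite openE => _ [x Ux <-].
  exact/chart_embedding_near/oU.
move=> x g; split=> [[b' b'j [G [dG eG]]]|[G [dG eG]]].
- have [Phi [dPhi PhiP]] := chart_transition (bj x) b'j.
  have [_ PhiT] := nbhs_singleton PhiP _ (bj x) erefl.
  have cPhi P := @near_comp _ _ _ Phi _ P (nbhs_singleton dPhi).
  exists (G \o (Phi \o Theta)); split.
    rewrite PhiT in dG; move/cPhi: dG => dG.
    have : \forall q \near chart b (j x),
        differentiable Phi q /\ differentiable G (Phi q).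
      by apply: filterS2 dPhi dG => q dPhiq dGq; split.
    rewrite chart_j => /cTheta dPhiG; apply: filterS dPhiG => p [dPhip dGp].
    exact: (differentiable_comp (differentiable_comp (dTheta p) dPhip) dGp).
  have eGj : \forall x' \near x, g (j x') = G (chart b' (j x')).
    exact: (chart_embedding_cts eG).
  have := PhiP; rewrite chart_j => /cTheta /near_subset PhiTheta.
  apply: filterS2 eGj PhiTheta => x' gx' Phix'.
  rewrite /= gx'; congr G.
  by have [] := Phix' (j x') (bj x') (chart_j x').
- exists b => //; exists (G \o Psi); split.
    rewrite -[set_val x]ThetaK -chart_j in dG; move/cPsi: dG.
    by apply: filterS => p dG; exact: (differentiable_comp (dPsi p) dG).
  apply: filterS (chart_embedding_near eG) => _ [x' gx' <-].
  by move: gx'; rewrite /= chart_j ThetaK.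
Qed.

End Embedding.

(** * Subschemes of graphs over the z-axis *)

Section GraphIdeal.
Variables (R : realType) (n : nat).
Local Notation C := R[i].
Local Notation poly3 := (mpoly 3 C).
Implicit Types (A U V : {poly C}) (f g : poly3).

(** Restriction of functions to the curve [u = U(z), v = V(z)], which is
    parametrized by [z]. *)
Definition eval_curve U V : poly3 -> {poly C} :=
  mmap (polyC : C -> {poly C}) (fun i : 'I_3 => [:: U; V; 'X]`_i).

Lemma eval_curveD U V f g :
  eval_curve U V (f + g) = eval_curve U V f + eval_curve U V g.
Proof. exact: rmorphD. Qed.

Lemma eval_curveM U V f g :
  eval_curve U V (f * g) = eval_curve U V f * eval_curve U V g.
Proof. exact: rmorphM. Qed.

Lemma eval_curveZ U V c f : eval_curve U V (c *: f) = c *: eval_curve U V f.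
Proof. by rewrite /eval_curve mmapZ mul_polyC. Qed.

Lemma eval_curve_u U V : eval_curve U V (u_ R) = U.
Proof. by rewrite /eval_curve /u_ /var mmapX mmap1U inordK. Qed.

Lemma eval_curve_v U V : eval_curve U V (v_ R) = V.
Proof. by rewrite /eval_curve /v_ /var mmapX mmap1U inordK. Qed.

Lemma eval_curve_z U V : eval_curve U V (z_ R) = 'X.
Proof. by rewrite /eval_curve /z_ /var mmapX mmap1U inordK. Qed.

Lemma eval_curveB U V f g :
  eval_curve U V (f - g) = eval_curve U V f - eval_curve U V g.
Proof. exact: rmorphB. Qed.

Lemma eval_curve1 U V : eval_curve U V 1 = 1.
Proof. exact: rmorph1. Qed.

Lemma eval_curveX U V f k : eval_curve U V (f ^+ k) = eval_curve U V f ^+ k.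
Proof.
elim: k => [|k IH]; first by rewrite !expr0 eval_curve1.
by rewrite !exprS eval_curveM IH.
Qed.

Definition z_powers (i : 'I_n) : poly3 := z_ R ^+ i.

Lemma eval_curve_lincomb U V c : eval_curve U V (lincomb z_powers c) = rVpoly c.
Proof.
rewrite rVpoly_sum /eval_curve raddf_sum; apply: eq_bigr => i _ /=.
by rewrite -/(eval_curve U V _) eval_curveZ eval_curveX eval_curve_z.
Qed.

(** The ideal of the subscheme of the curve [u = U(z), v = V(z)] where
    [A(z) = 0]. *)
Definition graph_ideal A U V : set poly3 := [set f | A %| eval_curve U V f].

Lemma graph_is_ideal A U V : is_ideal (graph_ideal A U V).
Proof.
split=> [|f g|f g]; rewrite /graph_ideal /=.
- by rewrite /eval_curve rmorph0 dvdp0.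
- by rewrite eval_curveD; exact: dvdp_add.
- by rewrite eval_curveM; exact: dvdp_mull.
Qed.

Section Monic.
Variable A : {poly C}.
Hypotheses (monA : A \is monic) (szA : size A = n.+1).

Let szmod (p : {poly C}) : (size (p %% A)%R <= n)%N.
Proof. by rewrite -ltnS -szA ltn_modp monic_neq0. Qed.

Lemma graph_quotient_basis U V : quotient_basis z_powers (graph_ideal A U V).
Proof.
move=> f; exists (poly_rV (eval_curve U V f %% A)).
rewrite /graph_ideal /=; split=> [|c].
  rewrite eval_curveB eval_curve_lincomb poly_rV_K // /dvdp modpD modpN.
  by rewrite modp_id subrr.
rewrite eval_curveB eval_curve_lincomb => dvd_c.
apply: (can_inj rVpolyK); rewrite poly_rV_K //.
move: dvd_c; rewrite /dvdp modpD modpN subr_eq0 => /eqP ->.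
by rewrite modp_small // szA ltnS size_poly.
Qed.

Lemma coords_graph (F : poly3) (J : Hilb n F) U V f :
  proj1_sig J = graph_ideal A U V ->
  coords z_powers J f = poly_rV (eval_curve U V f %% A).
Proof.
move=> defJ; have bJ : in_chart z_powers J.
  by rewrite /in_chart defJ; exact: graph_quotient_basis.
apply: (coords_unique bJ); rewrite defJ /graph_ideal /=.
rewrite eval_curveB eval_curve_lincomb poly_rV_K // /dvdp modpD modpN.
by rewrite modp_id subrr.
Qed.

End Monic.

Definition graph_chart A U V : chart_space R n :=
  let M (P : {poly C}) := \matrix_(i, k) ((P * 'X^i) %% A)`_k in
  (poly_rV (1 %% A), (M U, (M V, M 'X))).

Lemma chart_graph A U V (F : poly3) (J : Hilb n F) :
    A \is monic -> size A = n.+1 -> proj1_sig J = graph_ideal A U V ->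
  chart z_powers J = graph_chart A U V.
Proof.
move=> monA szA defJ; rewrite /chart /graph_chart.
rewrite (coords_graph monA szA _ defJ) eval_curve1.
have multE f : mult_mx z_powers J f =
    \matrix_(i, k) ((eval_curve U V f * 'X^i) %% A)`_k.
  apply/matrixP => i k; rewrite !mxE (coords_graph monA szA _ defJ) mxE.
  by rewrite eval_curveM eval_curveX eval_curve_z.
by rewrite !multE eval_curve_u eval_curve_v eval_curve_z.
Qed.

Implicit Type p : chart_space R n.

(** In the chart of the powers of [z], the coordinates of [u], [v], [z ^+ n] are
    obtained from those of [1] by multiplication matrices; they give the [U],
    [V], [A] of the subscheme. *)
Definition chart_U p : {poly C} := rVpoly (p.1 *m p.2.1).
Definition chart_V p : {poly C} := rVpoly (p.1 *m p.2.2.1).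
Definition chart_A p : {poly C} := 'X^n - rVpoly (p.1 *m p.2.2.2 ^+ n).

Lemma size_chart_U p : (size (chart_U p) <= n)%N.
Proof. exact: size_poly. Qed.

Lemma size_chart_V p : (size (chart_V p) <= n)%N.
Proof. exact: size_poly. Qed.

Lemma size_chart_A p : size (chart_A p) = n.+1.
Proof. by rewrite size_polyDl size_polyXn // size_polyN ltnS size_poly. Qed.

Lemma chart_A_monic p : chart_A p \is monic.
Proof.
rewrite monicE lead_coefDl ?lead_coefXn // size_polyXn size_polyN ltnS.
exact: size_poly.
Qed.

Section ChartRead.
Variables (F : poly3) (J : Hilb n F).
Hypothesis bJ : in_chart z_powers J.
Let p := chart z_powers J.

Let chart_UE : chart_U p = rVpoly (coords z_powers J (u_ R)).
Proof. by rewrite -[in RHS](mulr1 (u_ R)) coordsM. Qed.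

Let chart_VE : chart_V p = rVpoly (coords z_powers J (v_ R)).
Proof. by rewrite -[in RHS](mulr1 (v_ R)) coordsM. Qed.

Let chart_AE : chart_A p = 'X^n - rVpoly (coords z_powers J (z_ R ^+ n)).
Proof.
have multX k : mult_mx z_powers J (z_ R ^+ k) = mult_mx z_powers J (z_ R) ^+ k.
  elim: k => [|k IH]; last by rewrite exprSr exprS mult_mxM // IH.
  by rewrite !expr0 -(scale1r 1) mult_mxC.
by rewrite -[X in coords _ _ X](mulr1 (z_ R ^+ n)) coordsM // multX.
Qed.

(** The relations that express [u], [v], [z ^+ n] in the powers of [z] generate
    the ideal: they reduce every polynomial to a combination of the basis, which
    lies in the ideal only if it is 0. *)
Lemma ideal_of_chart :
  proj1_sig J = graph_ideal (chart_A p) (chart_U p) (chart_V p).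
Proof.
set A := chart_A p; set U := chart_U p; set V := chart_V p.
have [monA szA] := (chart_A_monic p, size_chart_A p).
(* The evaluation of a univariate polynomial at [z]. *)
have [inz [inzD inzM inzC inzX inz_rV]] : exists inz : {poly C} -> poly3,
    [/\ {morph inz : P Q / P + Q}, {morph inz : P Q / P * Q},
        forall c, inz c%:P = c%:A, inz 'X = z_ R &
        forall c, inz (rVpoly c) = lincomb z_powers c].
  exists (horner_alg (z_ R)); split; [exact: rmorphD | exact: rmorphM | | |].
  - exact: horner_algC.
  - exact: horner_algX.
  move=> c; rewrite rVpoly_sum raddf_sum; apply: eq_bigr => i _ /=.
  by rewrite linearZ rmorphXn /= horner_algX mulr_algl.
have inzB P Q : inz (P - Q) = inz P - inz Q.
  by apply/eqP; rewrite eq_sym subr_eq -inzD subrK.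
have inzXn k : inz 'X^k = z_ R ^+ k.
  elim: k => [|k IH]; last by rewrite !exprS inzM inzX IH.
  by rewrite !expr0 -[RHS]scale1r -inzC.
have inzA : proj1_sig J (inz A).
  rewrite /A chart_AE inzB inzXn inz_rV; exact: coordsP.
have inzU : proj1_sig J (u_ R - inz U).
  by rewrite /U chart_UE inz_rV; exact: coordsP.
have inzV : proj1_sig J (v_ R - inz V).
  by rewrite /V chart_VE inz_rV; exact: coordsP.
rewrite -/A in monA szA; clearbody A U V.
have inz_eval f : proj1_sig J (f - inz (eval_curve U V f)).
  elim/poly3_ind: f => [c||||f g If Ig|f g If Ig].
  - rewrite eval_curveZ eval_curve1 alg_polyC inzC subrr.
    exact: Hilb_ideal0.
  - rewrite eval_curve_u; exact: inzU.
  - rewrite eval_curve_v; exact: inzV.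
  - rewrite eval_curve_z inzX subrr; exact: Hilb_ideal0.
  - rewrite eval_curveD inzD opprD addrACA.
    exact: (Hilb_idealD If Ig).
  - rewrite eval_curveM inzM.
    rewrite -(subrK (f * inz (eval_curve U V g)) (f * g)) -mulrBr -addrA -mulrBl.
    exact: (Hilb_idealD (Hilb_idealM _ Ig) (Hilb_idealMr _ If)).
apply/seteqP; split=> [f If|f]; rewrite /graph_ideal /=; last first.
  move=> /dvdpP[q eq_q].
  rewrite -(subrK (inz (eval_curve U V f)) f); apply: (Hilb_idealD (inz_eval f)).
  by rewrite eq_q inzM; exact: (Hilb_idealM _ inzA).
have szr : (size (eval_curve U V f %% A)%R <= n)%N.
  by rewrite -ltnS -szA ltn_modp monic_neq0.
rewrite /dvdp -(poly_rV_K szr); apply/eqP.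
rewrite -(coords_lincomb bJ (poly_rV _)) -inz_rV poly_rV_K //.
suff /(coords_eq0 bJ) -> : proj1_sig J (inz (eval_curve U V f %% A)).
  exact: linear0.
have -> : inz (eval_curve U V f %% A) =
    f - (f - inz (eval_curve U V f)) - inz (eval_curve U V f %/ A) * inz A.
  rewrite subKr {2}(divp_eq (eval_curve U V f) A) inzD inzM.
  by rewrite addrC addKr.
exact: (Hilb_idealB (Hilb_idealB If (inz_eval f)) (Hilb_idealM _ inzA)).
Qed.

Lemma chart_of_ideal A U V :
    A \is monic -> size A = n.+1 -> (size U <= n)%N -> (size V <= n)%N ->
    proj1_sig J = graph_ideal A U V ->
  [/\ chart_A p = A, chart_U p = U & chart_V p = V].
Proof.
move=> monA szA szU szV defJ; rewrite chart_AE chart_UE chart_VE.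
rewrite !(coords_graph monA szA _ defJ) eval_curve_u eval_curve_v.
rewrite eval_curveX eval_curve_z.
have szmod (q : {poly C}) : (size (q %% A)%R <= n)%N.
  by rewrite -ltnS -szA ltn_modp monic_neq0.
have szXA : (size ('X^n - A)%R <= n)%N.
  by apply: size_monicB => //; rewrite ?monicXn ?size_polyXn.
rewrite !poly_rV_K // (modp_small (p := U)) ?szA // (modp_small (p := V)) ?szA //.
suff -> : 'X^n %% A = 'X^n - A by rewrite subKr.
by rewrite -{1}(subrK A 'X^n) modpD modpp addr0 modp_small // szA.
Qed.

End ChartRead.
End GraphIdeal.

Section GraphEmbedding.
Variables (R : realType) (n : nat).
Local Notation C := R[i].

Section ChartFamilies.
Variable p : chart_space R n.

Let d2 := differentiable_snd p.
Let d22 := differentiable_comp d2 (differentiable_snd p.2).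

Lemma differentiable_chart_U : differentiable_poly p (@chart_U R n).
Proof.
apply: differentiable_rVpoly; apply: differentiable_mulmx.
  exact: differentiable_fst.
exact: (differentiable_comp d2 (differentiable_fst _)).
Qed.

Lemma differentiable_chart_V : differentiable_poly p (@chart_V R n).
Proof.
apply: differentiable_rVpoly; apply: differentiable_mulmx.
  exact: differentiable_fst.
exact: (differentiable_comp d22 (differentiable_fst _)).
Qed.

Lemma differentiable_chart_A : differentiable_poly p (@chart_A R n).
Proof.
apply: differentiable_polyD; first exact: differentiable_polyC.
apply: differentiable_polyN; apply: differentiable_rVpoly.
apply: differentiable_mulmx; first exact: differentiable_fst.
suff dX k : differentiable (fun q : chart_space R n => q.2.2.2 ^+ k : 'M[C]_n) p.
  exact: dX.
elim: k => [|k IH]; first exact: differentiable_cst.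
under eq_fun do rewrite exprS; apply: differentiable_mulmx => //.
exact: (differentiable_comp d22 (differentiable_snd _)).
Qed.

End ChartFamilies.

Variables (E : normedModType C) (S : set E).
Variables (pA pU pV : E -> {poly C}).

Lemma differentiable_graph_chart x :
    (forall p, pA p \is monic) -> (forall p, size (pA p) = n.+1) ->
    (forall p, (size (pU p) <= n)%N) -> (forall p, (size (pV p) <= n)%N) ->
    differentiable_poly x pA -> differentiable_poly x pU ->
    differentiable_poly x pV ->
  differentiable (fun p => graph_chart n (pA p) (pU p) (pV p)) x.
Proof.
move=> monA szA szU szV dA dU dV.
have dM (Q : E -> {poly C}) : (forall p, (size (Q p) <= n.+2)%N) ->
    differentiable_poly x Q ->
    differentiable (fun p => \matrix_(i < n, k < n) ((Q p * 'X^i) %% pA p)`_k) x.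
  move=> szQ dQ; apply/differentiable_mxP => i k; under eq_fun do rewrite mxE.
  apply: (differentiable_poly_modp (k := i.+2) monA szA) => // [p|].
    apply: leq_trans (size_polyMleq _ _) _; rewrite size_polyXn.
    by rewrite addnS /= !addnS -!addSn leq_add2r.
  by apply: differentiable_polyM => //; exact: differentiable_polyC.
have le_n2 : (n <= n.+2)%N by rewrite -addn2 leq_addr.
do ![apply: differentiable_pair].
- apply/differentiable_mxP => i k; under eq_fun do rewrite mxE.
  apply: (differentiable_poly_modp (k := 1) monA szA) => // p.
  by rewrite size_poly1 addn1.
- by apply: dM => // p; exact: leq_trans le_n2.
- by apply: dM => // p; exact: leq_trans le_n2.
- apply: dM => [p|]; first by rewrite size_polyX.
  exact: differentiable_polyC.
Qed.

(** If [S] is parametrized by the triples [A], [U], [V] for which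
    [graph_ideal A U V] contains [F], with differentiable dependence in both
    directions, then [S] is isomorphic to the chart of the powers of [z]. *)
Lemma graph_embedding (F : mpoly 3 C) (inv : {poly C} -> {poly C} -> {poly C} -> E) :
    (forall p, pA p \is monic) -> (forall p, size (pA p) = n.+1) ->
    (forall p, (size (pU p) <= n)%N) -> (forall p, (size (pV p) <= n)%N) ->
    (forall x, differentiable_poly x pA) -> (forall x, differentiable_poly x pU) ->
    (forall x, differentiable_poly x pV) ->
    (forall x, S x -> pA x %| eval_curve (pU x) (pV x) F) ->
    (forall x, S x -> inv (pA x) (pU x) (pV x) = x) ->
    (forall q : chart_space R n,
       differentiable (fun p => inv (chart_A p) (chart_U p) (chart_V p)) q) ->
    (forall A U V : {poly C}, A \is monic -> size A = n.+1 -> (size U <= n)%N ->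
       (size V <= n)%N -> A %| eval_curve U V F ->
       [/\ S (inv A U V), pA (inv A U V) = A, pU (inv A U V) = U &
           pV (inv A U V) = V]) ->
  exists j : S -> Hilb n F,
    open_holomorphic_embedding (@hol_subset R E S) (@hol_Hilb R n F) j.
Proof.
move=> monA szA szU szV dA dU dV dvdF invK dinv Kinv.
pose I (x : S) := graph_ideal (pA (set_val x)) (pU (set_val x)) (pV (set_val x)).
have jP x : [/\ is_ideal (I x), I x F &
    exists b : 'I_n -> mpoly 3 C, quotient_basis b (I x)].
  split; first exact: graph_is_ideal.
    exact/dvdF/set_valP.
  by exists (@z_powers R n); exact: graph_quotient_basis.
pose j (x : S) : Hilb n F := exist _ _ (jP x).
have bj x : in_chart (@z_powers R n) (j x) by exact: graph_quotient_basis.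
exists j; apply: (chart_embedding (b := @z_powers R n)
    (Theta := fun p => graph_chart n (pA p) (pU p) (pV p))
    (Psi := fun p => inv (chart_A p) (chart_U p) (chart_V p))) => //.
- by move=> p; exact: differentiable_graph_chart.
- by move=> x; exact: chart_graph.
- move=> x; rewrite -(@chart_graph R n _ _ _ F (j x)) //.
  by have [//|//|//|//|//|-> -> ->] := @chart_of_ideal R n F (j x) (bj x)
    (pA (set_val x)) (pU (set_val x)) (pV (set_val x)); exact/invK/set_valP.
move=> J bJ; set p := chart (@z_powers R n) J.
have defJ := ideal_of_chart bJ.
have dvdJ : chart_A p %| eval_curve (chart_U p) (chart_V p) F.
  by have := Hilb_ideal_eqn J; rewrite defJ.
have [Sx eA eU eV] := Kinv _ _ _ (chart_A_monic p) (size_chart_A p)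
  (size_chart_U p) (size_chart_V p) dvdJ.
exists (SigSub (mem_set Sx)); apply: Hilb_inj.
by rewrite defJ /= /I eA eU eV.
Qed.

End GraphEmbedding.

(** * Eigenvectors and the adjoint quotient *)

Section Eigenvectors.
Variables (K : fieldType) (k : nat).
Implicit Types (Y S : 'M[K]_k) (v : 'cV[K]_k).

(** On the eigenspace of [S] for [x], the matrix [Y - x] is nilpotent; the last
    nonzero vector [(Y - x) ^+ j *m v] is the eigenvector. *)
Lemma eigenvector_of_commuting_nilpotent Y S e x v :
    comm_mx S Y -> (Y - S) ^+ e = 0 -> S *m v = x *: v -> v != 0 ->
  exists2 w : 'cV_k, w != 0 & Y *m w = x *: w.
Proof.
move=> cSY nilN Sv v_neq0; pose N := Y - S.
have Neig j : S *m (N ^+ j *m v) = x *: (N ^+ j *m v).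
  have cSN : GRing.comm S N.
    by rewrite /GRing.comm /N mulrBr mulrBl; congr (_ - _); exact: cSY.
  have := commrX j cSN; rewrite /GRing.comm -[S * _]/(S *m _) -[_ * S]/(_ *m S).
  by move=> cSNj; rewrite mulmxA cSNj -mulmxA Sv scalemxAr.
have exN : exists j, N ^+ j *m v == 0 by exists e; rewrite nilN mul0mx.
case: (ex_minnP exN) => -[|j]; first by rewrite expr0 mul1mx (negPf v_neq0).
move=> /eqP Nj0 minj; exists (N ^+ j *m v).
  by apply/negP => /minj; rewrite ltnn.
rewrite -(subrK S Y) -/N mulmxDl Neig mulmxA.
by rewrite -[N *m _]/(N * _) -exprS Nj0 add0r.
Qed.

(** Applying the product of the [Y - x 0 j], for all [j] but one, to a linear
    relation between the eigenvectors isolates a single term. *)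
Lemma eigenvectors_unitmx Y (G : 'M[K]_k) (x : 'rV[K]_k) :
    injective (x 0) -> Y *m G = G *m diag_mx x -> (forall i, col i G != 0) ->
  G \in unitmx.
Proof.
move=> x_inj YG G_neq0; rewrite -unitmx_tr -row_free_unit.
apply/inj_row_free => c /(congr1 trmx); rewrite trmx_mul trmxK linear0 => Gc.
have kill (s : seq 'I_k) :
    G *m (\col_i ((\prod_(j <- s) (x 0 i - x 0 j)) * c 0 i)) = 0.
  elim: s => [|j s IH].
    by rewrite -[RHS]Gc; congr (_ *m _); apply/colP => i; rewrite !mxE big_nil mul1r.
  set w := (X in G *m X = 0) in IH.
  have -> : (\col_i ((\prod_(j' <- j :: s) (x 0 i - x 0 j')) * c 0 i)) =
      diag_mx x *m w - x 0 j *: w.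
    apply/colP => i; rewrite mul_diag_mx !mxE big_cons -mulrA.
    by rewrite mulrBl.
  by rewrite mulmxBr mulmxA -YG -mulmxA IH mulmx0 -scalemxAr IH scaler0 subrr.
apply/rowP => i; rewrite mxE.
have := kill (rem i (enum 'I_k)); set w := (X in G *m X = 0).
have def_w : w = ((\prod_(j <- rem i (enum 'I_k)) (x 0 i - x 0 j)) * c 0 i)
    *: delta_mx i 0.
  apply/colP => i'; rewrite !mxE eqxx andbT; case: eqVneq => [->|ne_i].
    by rewrite mulr1.
  rewrite (bigD1_seq i') /= ?subrr ?mul0r ?mulr0 //.
    by rewrite mem_rem_uniq ?enum_uniq // inE ne_i mem_enum.
  by rewrite rem_uniq ?enum_uniq.
rewrite def_w -scalemxAr -colE => /eqP; rewrite scaler_eq0 (negPf (G_neq0 i)) orbF.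
rewrite mulf_eq0 => /orP[|/eqP //].
rewrite prodf_seq_eq0 => /hasP[j + /=]; rewrite mem_rem_uniq ?enum_uniq // !inE.
move=> /andP[ne_ji _]; rewrite subr_eq0 => /eqP/x_inj eq_ij.
by rewrite eq_ij eqxx in ne_ji.
Qed.

End Eigenvectors.

Section Fiber.
Variables (R : realType) (k : nat).
Local Notation C := R[i].
Implicit Types (Y g : 'M[C]_(k + k)) (t : seq C).

Lemma symplectic_formV : symplectic_form R k *m - symplectic_form R k = 1%:M.
Proof.
rewrite mulmxN /symplectic_form mulmx_block !mul0mx !mulmx0 !mul1mx !mulmx1.
rewrite !(add0r, addr0) opp_block_mx !opprK !oppr0.
by rewrite -scalar_mx_block.
Qed.

Lemma Sp_unitmx g : Sp g -> g \in unitmx.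
Proof.
move=> Spg.
have : - symplectic_form R k *m (g^T *m symplectic_form R k) *m g = 1%:M.
  by rewrite -mulmxA Spg mulNmx -mulmxN symplectic_formV.
by case/mulmx1_unit.
Qed.

Lemma sp_skew Y : sp Y -> Y^T *m symplectic_form R k = - (symplectic_form R k *m Y).
Proof.
move=> [P [Q [S [symQ symS ->]]]].
rewrite /symplectic_form tr_block_mx !mulmx_block !mul0mx !mulmx0 !mul1mx !mulmx1.
rewrite !(add0r, addr0) opp_block_mx symQ symS opprK.
have trN : (- P^T)^T = - P by rewrite linearN /= trmxK.
by rewrite trN !mulmxN !mulmx1 !mulNmx !mul1mx !opprK.
Qed.

(** The semisimple part is conjugate to an element of the Cartan subalgebra with
    [x] on the diagonal, so that it has [x] as eigenvalue, and so does [Y]. *)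
Lemma adjoint_quotient_eigenvector Y t x : adjoint_quotient Y t -> x ^+ 2 \in t ->
  exists2 v : 'cV_(k + k), v != 0 & Y *m v = x *: v.
Proof.
move=> [_ [S [g [d [[_ cSY [e nilN]] Spg defS permt]]]]] xt.
have ug := Sp_unitmx Spg.
have : x ^+ 2 \in [seq d ord0 i ^+ 2 | i : 'I_k] by rewrite (perm_mem permt).
case/mapP=> i _ /eqP; rewrite eqf_sqr => def_x.
have [s def_s] : exists s : 'I_(k + k), row_mx d (- d) 0 s = x.
  case/orP: def_x => /eqP ->; first by exists (lshift k i); rewrite row_mxEl.
  by exists (rshift k i); rewrite row_mxEr mxE.
apply: (eigenvector_of_commuting_nilpotent cSY nilN (v := g *m delta_mx s 0)).
  rewrite defS !mulmxA mulmxKV // -mulmxA scalemxAr; congr (_ *m _).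
  apply/colP => r; rewrite /cartan mul_diag_mx !mxE.
  by case: eqVneq => [->|_]; rewrite ?mulr0 // -def_s !mxE.
apply/negP => /eqP /(congr1 (mulmx (invmx g))); rewrite mulKmx // mulmx0.
by move=> /colP/(_ s)/eqP; rewrite !mxE !eqxx oner_eq0.
Qed.

(** The eigenvectors for the [2 k] square roots form a basis, in which the
    symplectic form pairs only those for [x] and [- x]; rescaling half of them
    makes the basis symplectic. *)
Lemma eigenvectors_adjoint_quotient Y t : size t = k -> uniq t -> 0 \notin t ->
    sp Y ->
    (forall x, x ^+ 2 \in t -> exists2 v : 'cV_(k + k), v != 0 & Y *m v = x *: v) ->
  adjoint_quotient Y t.
Proof.
move=> szt uniq_t nz_t spY eigY.
pose x : 'rV[C]_k := \row_i sqrtC t`_i.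
have x2 i : x 0 i ^+ 2 = t`_i by rewrite mxE sqrtCK.
have lt_t (i : 'I_k) : (i < size t)%N by rewrite szt.
pose lam : 'rV[C]_(k + k) := row_mx x (- x).
have laml i : lam 0 (lshift k i) = x 0 i by rewrite row_mxEl.
have lamr i : lam 0 (rshift k i) = - x 0 i by rewrite row_mxEr mxE.
have lam2 s : lam 0 s ^+ 2 \in t.
  by case: (split_ordP s) => i ->; rewrite (laml, lamr) ?sqrrN x2 mem_nth.
have x_neqN i j : x 0 i != - x 0 j.
  apply/eqP => xij; have : t`_i = t`_j by rewrite -!x2 xij sqrrN.
  move=> /eqP; rewrite nth_uniq // => /eqP/val_inj eq_ij.
  move: xij => /eqP; rewrite eq_ij -addr_eq0 -mulr2n mulrn_eq0 /= => /eqP xj0.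
  have := mem_nth 0 (lt_t j); rewrite -x2 xj0 expr0n /=; exact/negP.
have x_inj : injective (x 0).
  move=> i j xij; apply: val_inj; apply/eqP.
  by rewrite -(nth_uniq 0 (lt_t i) (lt_t j) uniq_t) -!x2 xij.
have lam_inj : injective (lam 0).
  move=> s s'; case: (split_ordP s) (split_ordP s') => i -> [] j ->;
    rewrite !(laml, lamr).
  - by move=> /x_inj ->.
  - by move=> /eqP; rewrite (negPf (x_neqN _ _)).
  - by move=> /esym/eqP; rewrite (negPf (x_neqN _ _)).
  - by move=> /oppr_inj/x_inj ->.
have eigV s : exists v : 'cV_(k + k), v != 0 /\ Y *m v = lam 0 s *: v.
  by have [v v_neq0 Yv] := eigY _ (lam2 s); exists v.
have [V VP] := boolp.choice eigV.
have [V_neq0 YV] : (forall s, V s != 0) /\ (forall s, Y *m V s = lam 0 s *: V s).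
  by split=> s; case: (VP s).
pose G := \matrix_(r, s) V s r 0 : 'M[C]_(k + k).
have YG : Y *m G = G *m diag_mx lam.
  apply/matrixP => r s; rewrite mul_mx_diag [in RHS]mxE [G _ _]mxE mulrC.
  have := congr1 (fun w : 'cV_(k + k) => w r 0) (YV s); rewrite [X in _ = X]mxE => <-.
  by rewrite !mxE; apply: eq_bigr => q _; rewrite mxE.
have uG : G \in unitmx.
  apply: (eigenvectors_unitmx lam_inj YG) => s.
  by rewrite (_ : col s G = V s) //; apply/colP => r; rewrite !mxE.
pose J := symplectic_form R k; pose K := G^T *m J *m G.
have uJ : J \in unitmx by case: (mulmx1_unit symplectic_formV).
have uK : K \in unitmx by rewrite !unitmx_mul unitmx_tr uG uJ.
have skewK : diag_mx lam *m K = - (K *m diag_mx lam).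
  have trYG : diag_mx lam *m G^T = G^T *m Y^T.
    by rewrite -[diag_mx lam]tr_diag_mx -!trmx_mul YG.
  rewrite /K !mulmxA trYG -[G^T *m _ *m J]mulmxA sp_skew //.
  rewrite -[_ *m G *m diag_mx _]mulmxA -YG.
  by rewrite mulmxN mulNmx !mulmxA.
have trK : K^T = - K.
  rewrite /K !trmx_mul trmxK mulmxA -mulNmx -mulmxN; congr (_ *m _ *m _).
  rewrite /J /symplectic_form tr_block_mx opp_block_mx !linear0 !linearN /=.
  by rewrite !trmx1 ?opprK ?oppr0.
have defK : K = G^T *m J *m G by []; clearbody K.
have orthoK s s' : lam 0 s != - lam 0 s' -> K s s' = 0.
  move=> ne_ss'; have /matrixP/(_ s s') := skewK.
  rewrite mul_diag_mx mul_mx_diag [LHS]mxE [RHS]mxE [X in - X]mxE => /eqP.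
  rewrite -addr_eq0 mulrC -mulrDr.
  by rewrite mulf_eq0 addr_eq0 (negPf ne_ss') orbF => /eqP.
pose dl i := K (lshift k i) (rshift k i).
have Kll i j : K (lshift k i) (lshift k j) = 0 by rewrite orthoK ?laml.
have Krr i j : K (rshift k i) (rshift k j) = 0.
  by rewrite orthoK ?lamr // opprK eq_sym.
have Klr i j : K (lshift k i) (rshift k j) = (i == j)%:R * dl i.
  case: eqVneq => [->|ne_ij]; first by rewrite mul1r.
  by rewrite mul0r orthoK // laml lamr opprK (inj_eq x_inj).
have Krl i j : K (rshift k i) (lshift k j) = - ((i == j)%:R * dl i).
  have /matrixP/(_ (lshift k j) (rshift k i)) := trK; rewrite mxE => ->.
  by rewrite mxE Klr eq_sym; case: eqVneq => [->|]; rewrite ?mul0r.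
have dl_neq0 i : dl i != 0.
  apply/eqP => dl0; have : delta_mx 0 (lshift k i) *m K = 0 :> 'rV_(k + k).
    apply/rowP => s; rewrite -rowE !mxE.
    case: (split_ordP s) => j ->; rewrite ?Kll // Klr.
    by case: eqP => [_|]; rewrite ?dl0 ?mulr0 ?mul0r.
  move=> /(congr1 (mulmx^~ (invmx K))); rewrite mulmxK // mul0mx.
  by move=> /rowP/(_ (lshift k i))/eqP; rewrite !mxE !eqxx oner_eq0.
pose sc : 'rV[C]_(k + k) := row_mx (const_mx 1) (\row_i (dl i)^-1).
have scl i : sc 0 (lshift k i) = 1 by rewrite row_mxEl mxE.
have scr i : sc 0 (rshift k i) = (dl i)^-1 by rewrite row_mxEr mxE.
pose g := G *m diag_mx sc.
have Spg : Sp g.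
  rewrite /Sp /= /g trmx_mul tr_diag_mx -/J.
  have -> : diag_mx sc *m G^T *m J *m (G *m diag_mx sc) =
      diag_mx sc *m (K *m diag_mx sc) by rewrite defK !mulmxA.
  apply/matrixP => s s'; rewrite mul_diag_mx mul_mx_diag [LHS]mxE [X in _ * X]mxE.
  case: (split_ordP s) (split_ordP s') => i -> [] j ->.
  - by rewrite Kll mul0r mulr0 /J block_mxEul mxE.
  - rewrite Klr scl scr mul1r /J block_mxEur mxE; case: eqVneq => [->|_].
      by rewrite mul1r mulfV.
    by rewrite !mul0r.
  - rewrite Krl scl scr mulr1 mulrN /J block_mxEdl !mxE; case: eqVneq => [->|_].
      by rewrite mul1r mulVf.
    by rewrite !mul0r mulr0.
  - by rewrite Krr mul0r mulr0 /J block_mxEdr mxE.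
have ug := Sp_unitmx Spg.
have defY : Y = g *m cartan x *m invmx g.
  apply: (canRL (mulmxK ug)); rewrite /g /cartan -/lam mulmxA YG -!mulmxA.
  by rewrite diag_mxC.
split=> //; exists Y, g, x; split=> //.
  split=> //; last by exists 1%N; rewrite subrr expr1.
  exists (invmx g); rewrite ?unitmx_inv //.
  apply/similar_diagPex; exists lam; apply/similarP; rewrite ?unitmx_inv //.
  by rewrite {1}defY -[g *m _ *m _]mulmxA mulKmx.
apply/permP => P; congr (count P _); apply: (@eq_from_nth _ 0).
  by rewrite size_map -cardE card_ord szt.
move=> i; rewrite size_map -cardE card_ord => lt_ik.
rewrite (nth_map (Ordinal lt_ik)) -?cardE ?card_ord // x2; congr (_`_ _).
by rewrite nth_enum_ord.
Qed.

End Fiber.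

(** * Eigenvalues of the matrices of the slice *)

Section SliceEigenvectors.
Variable K : fieldType.

Lemma sum_delta q j (f : nat -> K) :
  \sum_(k < q) (j == k :> nat)%:R * f k = if (j < q)%N then f j else 0.
Proof.
case: ifP => [lt_jq|ge_jq].
  rewrite (bigD1 (Ordinal lt_jq)) //= eqxx mul1r big1 ?addr0 // => k.
  rewrite -(inj_eq val_inj) /= eq_sym => /negPf ->; exact: mul0r.
apply: big1 => k _; case: eqP => [eq_jk|_]; last exact: mul0r.
by rewrite eq_jk ltn_ord in ge_jq.
Qed.

(** Entries are given by functions on [nat], so that neighbours of an index can be
    named without ordinals. *)
Definition colf l (f : nat -> K) : 'cV[K]_l := \col_(i < l) f i.

Lemma colfE l (x : 'cV[K]_l) : exists f, x = colf l f.
Proof.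
exists (fun i => (rVpoly x^T)`_i); apply/colP => i.
by rewrite !mxE coef_rVpoly_ord mxE.
Qed.

(** This eliminates [w] from the system [(J^T + x) w = g], where [J] is the
    nilpotent Jordan block, up to its last entry. *)
Lemma alternating_telescope l (w : nat -> K) x :
  \sum_(i < l) (- x) ^+ i * ((if (0 < i)%N then w i.-1 else 0) + x * w i) =
  - (- x) ^+ l * (if (0 < l)%N then w l.-1 else 0).
Proof.
elim: l => [|l IH]; first by rewrite big_ord0 mulr0.
rewrite big_ord_recr IH /= exprSr; case: l {IH} => [|l] /=.
  by rewrite expr0; ring.
by ring.
Qed.

End SliceEigenvectors.

Section Slice.
Variables (R : realType) (l n : nat).
Local Notation C := R[i].
Local Notation J := (jordan_nil R).
Local Notation E := (corner R).

Lemma mul_jordan k f i : (J k *m colf k f) i 0 = if (i.+1 < k)%N then f i.+1 else 0.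
Proof.
by rewrite mxE -(sum_delta k i.+1 f); apply: eq_bigr => j _; rewrite !mxE.
Qed.

Lemma mul_jordanT k f i :
  ((J k)^T *m colf k f) i 0 = if (0 < i)%N then f i.-1 else 0.
Proof.
rewrite mxE; case: i => -[|i] lti /=.
  by rewrite big1 // => j _; rewrite !mxE mul0r.
have := sum_delta k i f; rewrite (ltnW lti) => <-.
by apply: eq_bigr => j _; rewrite !mxE eqSS eq_sym.
Qed.

Lemma mul_corner p q f i :
  (E p q *m colf q f) i 0 = (i.+1 == p)%:R * (if (0 < q)%N then f q.-1 else 0).
Proof.
rewrite mxE; have := sum_delta q q.-1 f; case: q => [|q] /= eq_sum.
  by rewrite big_ord0 mulr0.
rewrite ltnSn in eq_sum; rewrite -eq_sum mulr_sumr.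
apply: eq_bigr => j _; rewrite !mxE eqSS [q == _]eq_sym -mulnb natrM.
by rewrite -mulrA.
Qed.

Lemma mul_cornerT p q f i :
  ((E p q)^T *m colf p f) i 0 = (i.+1 == q)%:R * (if (0 < p)%N then f p.-1 else 0).
Proof.
have -> : (E p q)^T = E q p by apply/matrixP => r s; rewrite !mxE andbC.
exact: mul_corner.
Qed.

(** The common form of the matrices of the slice in the cases [n < l], where
    [c = 0], and [n = l], where [c = z_n]. *)
Definition slice_shape (dd : 'rV[C]_l) (aa : 'rV[C]_n) (off : 'M[C]_(l, n)) (c : C) :
    'M[C]_((l + n) + (l + n)) :=
  block_mx (block_mx (J l) 0 (c *: E n l) (J n))
           (block_mx (E l l) 0 0 (E n n))
           (block_mx (diag_mx dd) off off^T (diag_mx aa))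
           (block_mx (- (J l)^T) (- (c *: E n l)^T) 0 (- (J n)^T)).

Section Eigen.
Variables (dd : 'rV[C]_l) (aa : 'rV[C]_n) (off : 'M[C]_(l, n)) (c x : C).
Hypotheses (l_gt0 : (0 < l)%N) (n0_c : n = 0%N -> c = 0) (x_neq0 : x != 0).
Let Y := slice_shape dd aa off c.

Lemma slice_shape_mul (p : 'cV[C]_l) (p' : 'cV[C]_n) w w' :
  Y *m col_mx (col_mx p p') (col_mx w w') =
  col_mx (col_mx (J l *m p + E l l *m w)
                 (c *: (E n l *m p) + J n *m p' + E n n *m w'))
         (col_mx (diag_mx dd *m p + off *m p' - (J l)^T *m w - c *: ((E n l)^T *m w'))
                 (off^T *m p + diag_mx aa *m p' - (J n)^T *m w')).
Proof.
rewrite mul_block_col !mul_block_col !mul0mx !addr0 !add0r.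
rewrite -scalemxAl linearZ /= !mulNmx -scalemxAl.
by rewrite !add_col_mx !addrA.
Qed.

Definition bilin (s t : C) := \sum_(p < l) \sum_(q < n) s ^+ p * off p q * t ^+ q.

(** The coefficients of the two equations left for an eigenvector with
    eigenvalue [x]. *)
Definition char_d :=
  (- x ^+ 2) ^+ l + \sum_(i < l) (- x ^+ 2) ^+ i * dd 0 i + c ^+ 2 * (- x ^+ 2) ^+ l.-1.
Definition char_a := (- x ^+ 2) ^+ n + \sum_(i < n) (- x ^+ 2) ^+ i * aa 0 i.
Definition char_b := bilin (- x) x - c * (- x) ^+ l.-1 * x ^+ n.
Definition char_b' := bilin x (- x) - c * (- x) ^+ n * x ^+ l.-1.

(** The four blocks of rows of [Y *m v = x *: v]. *)
Definition eigen_eqs (f f' w w' : nat -> C) :=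
  [/\ forall i : 'I_l, (if (i.+1 < l)%N then f i.+1 else 0) +
        (i.+1 == l)%:R * w l.-1 = x * f i,
      forall i : 'I_n, c * ((i.+1 == n)%:R * f l.-1) +
        (if (i.+1 < n)%N then f' i.+1 else 0) + (i.+1 == n)%:R * w' n.-1 = x * f' i,
      forall i : 'I_l, dd 0 i * f i + \sum_(q < n) off i q * f' q -
        (if (0 < i)%N then w i.-1 else 0) - c * ((i.+1 == l)%:R * w' n.-1) = x * w i &
      forall i : 'I_n, \sum_(p < l) off p i * f p + aa 0 i * f' i -
        (if (0 < i)%N then w' i.-1 else 0) = x * w' i].

Lemma eigen_eqsP f f' w w' :
  let v := col_mx (col_mx (colf l f) (colf n f')) (col_mx (colf l w) (colf n w')) in
  Y *m v = x *: v <-> eigen_eqs f f' w w'.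
Proof.
move=> v.
have -> : Y *m v = col_mx
    (col_mx (\col_i ((if (i.+1 < l)%N then f i.+1 else 0) + (i.+1 == l)%:R * w l.-1))
      (\col_i (c * ((i.+1 == n)%:R * f l.-1) +
        (if (i.+1 < n)%N then f' i.+1 else 0) + (i.+1 == n)%:R * w' n.-1)))
    (col_mx
      (\col_i (dd 0 i * f i + \sum_(q < n) off i q * f' q -
        (if (0 < i)%N then w i.-1 else 0) - c * ((i.+1 == l)%:R * w' n.-1)))
      (\col_i (\sum_(p < l) off p i * f p + aa 0 i * f' i -
        (if (0 < i)%N then w' i.-1 else 0)))).
  rewrite slice_shape_mul; congr (col_mx (col_mx _ _) (col_mx _ _)); apply/colP => i.
  - by rewrite [LHS]mxE mul_jordan mul_corner l_gt0 [RHS]mxE.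
  - have n_gt0 : (0 < n)%N by exact: leq_ltn_trans (ltn_ord i).
    rewrite [LHS]mxE [X in X + _]mxE [X in X + _ + _]mxE.
    by rewrite mul_jordan !mul_corner l_gt0 n_gt0 [RHS]mxE.
  - rewrite mul_diag_mx [LHS]mxE [X in X + _]mxE [X in X + _ + _]mxE.
    rewrite [X in X + _ + _ + _]mxE [X in _ + X + _ + _]mxE.
    rewrite [X in _ + X + _]mxE mul_jordanT [X in _ + X]mxE [X in _ - X]mxE mul_cornerT.
    rewrite [colf l f i 0]mxE [RHS]mxE; congr (_ + _ - _ - _).
      by apply: eq_bigr => q _; rewrite mxE.
    by case: posnP => // n0; rewrite n0_c // !mul0r.
  - rewrite mul_diag_mx [LHS]mxE [X in X + _]mxE [X in _ + X + _]mxE.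
    rewrite [X in _ + X]mxE mul_jordanT [X in X + _ + _]mxE [RHS]mxE.
    rewrite [colf n f' i 0]mxE; congr (_ + _ - _).
    by apply: eq_bigr => q _; rewrite !mxE.
rewrite !scale_col_mx; split.
  move=> /eq_col_mx[/eq_col_mx[/colP e1 /colP e2] /eq_col_mx[/colP e3 /colP e4]].
  by split=> i; [have := e1 i | have := e2 i | have := e3 i | have := e4 i];
    rewrite !mxE.
move=> [e1 e2 e3 e4]; congr (col_mx (col_mx _ _) (col_mx _ _));
  apply/colP => i; rewrite !mxE; [exact: e1|exact: e2|exact: e3|exact: e4].
Qed.

(** The equations satisfied by the first entries of the two chains. *)
Definition reduced_eqs (s s' : C) :=
  char_d * s + char_b * s' = 0 /\ char_b' * s + char_a * s' = 0.

Let Gd (f f' : nat -> C) (i : 'I_l) := dd 0 i * f i + \sum_(q < n) off i q * f' q.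
Let Ga (f f' : nat -> C) (i : 'I_n) := \sum_(p < l) off p i * f p + aa 0 i * f' i.

Lemma sum_Gd s s' :
  \sum_(i < l) (- x) ^+ i * Gd (fun k => x ^+ k * s) (fun k => x ^+ k * s') i =
  (\sum_(i < l) (- x ^+ 2) ^+ i * dd 0 i) * s + bilin (- x) x * s'.
Proof.
rewrite /Gd; under eq_bigr do rewrite mulrDr; rewrite big_split /=; congr (_ + _).
  rewrite mulr_suml; apply: eq_bigr => i _.
  by rewrite [- x ^+ 2](_ : _ = (- x) * x) ?exprMn //; ring.
rewrite /bilin mulr_suml; apply: eq_bigr => i _; rewrite mulr_suml mulr_sumr.
by apply: eq_bigr => q _; ring.
Qed.

Lemma sum_Ga s s' :
  \sum_(i < n) (- x) ^+ i * Ga (fun k => x ^+ k * s) (fun k => x ^+ k * s') i =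
  bilin x (- x) * s + (\sum_(i < n) (- x ^+ 2) ^+ i * aa 0 i) * s'.
Proof.
rewrite /Ga; under eq_bigr do rewrite mulrDr; rewrite big_split /=; congr (_ + _).
  rewrite /bilin exchange_big mulr_suml; apply: eq_bigr => i _ /=.
  rewrite mulr_suml mulr_sumr; by apply: eq_bigr => q _; ring.
rewrite mulr_suml; apply: eq_bigr => i _.
by rewrite [- x ^+ 2](_ : _ = (- x) * x) ?exprMn //; ring.
Qed.

Lemma geometric k (f : nat -> C) :
  (forall i, (i.+1 < k)%N -> f i.+1 = x * f i) ->
  forall i, (i < k)%N -> f i = x ^+ i * f 0%N.
Proof.
move=> fS; elim=> [|i IH] lt_ik; first by rewrite mul1r.
by rewrite fS // IH ?(ltnW lt_ik) // exprS mulrA.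
Qed.

Lemma chain_eq0 k (w : nat -> C) :
    (forall i : 'I_k, (if (0 < i)%N then w i.-1 else 0) + x * w i = 0) ->
  forall i, (i < k)%N -> w i = 0.
Proof.
move=> eqw; elim=> [|i IH] lt_ik; have := eqw (Ordinal lt_ik) => /= /eqP.
  by rewrite add0r mulf_eq0 (negPf x_neq0) => /eqP.
by rewrite IH ?(ltnW lt_ik) // add0r mulf_eq0 (negPf x_neq0) => /eqP.
Qed.

Lemma sum_last (W : C) :
  \sum_(i < l) (- x) ^+ i * (c * ((i.+1 == l)%:R * W)) = c * (- x) ^+ l.-1 * W.
Proof.
have lt_l1 : (l.-1 < l)%N by rewrite ltn_predL.
rewrite (bigD1 (Ordinal lt_l1)) //= prednK // eqxx big1 ?addr0 => [|i ne_i].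
  by rewrite mul1r mulrCA mulrA.
case: eqP => [eq_l|_]; last by rewrite mul0r !mulr0.
by case/eqP: ne_i; apply: val_inj; have := congr1 predn eq_l.
Qed.

Let split_power k : (- x ^+ 2) ^+ k = (- x) ^+ k * x ^+ k.
Proof. by rewrite -exprMn mulNr expr2. Qed.

Let xn0 k : (- x) ^+ k != 0.
Proof. by rewrite expf_neq0 // oppr_eq0. Qed.

Lemma eigen_eqs_powers f f' w w' : eigen_eqs f f' w w' ->
  (forall i : 'I_l, f i = x ^+ i * f 0%N) /\ (forall i : 'I_n, f' i = x ^+ i * f' 0%N).
Proof.
move=> [e1 e2 _ _]; split=> i.
  apply: (geometric (k := l)) => // k lt_kl.
  have := e1 (Ordinal (ltnW lt_kl)); rewrite /= lt_kl.
  by rewrite (ltn_eqF lt_kl) mul0r addr0.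
apply: (geometric (k := n)) => // k lt_kn.
have := e2 (Ordinal (ltnW lt_kn)); rewrite /= lt_kn.
by rewrite (ltn_eqF lt_kn) !mul0r mulr0 add0r addr0.
Qed.

(** The first two blocks of rows express [f], [f'] and the last entries of [w],
    [w'] by [f 0] and [f' 0]; the other two are summed with weights
    [(- x) ^+ i].  If [n = 0], then [f' 0] is not an entry of the vector, and 0
    stands for it. *)
Lemma eigen_eqs_reduced f f' w w' : eigen_eqs f f' w w' ->
  reduced_eqs (f 0%N) (if (0 < n)%N then f' 0%N else 0).
Proof.
move=> eqs; have [fE f'E0] := eigen_eqs_powers eqs; move: eqs => [e1 e2 e3 e4].
set s := f 0%N; set s' := if _ then _ else _.
have f'E (i : 'I_n) : f' i = x ^+ i * s'.
  by rewrite /s' (leq_ltn_trans _ (ltn_ord i)).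
have lt_l1 : (l.-1 < l)%N by rewrite ltn_predL.
have fl : f l.-1 = x ^+ l.-1 * s := fE (Ordinal lt_l1).
have wl : w l.-1 = x ^+ l * s.
  have := e1 (Ordinal lt_l1); rewrite /= prednK // ltnn eqxx mul1r add0r fl => ->.
  by rewrite mulrA -exprS prednK.
have w'n : (0 < n)%N -> w' n.-1 = x ^+ n * s' - c * (x ^+ l.-1 * s).
  move=> n_gt0; have lt_n1 : (n.-1 < n)%N by rewrite ltn_predL.
  have := e2 (Ordinal lt_n1); rewrite /= prednK // ltnn eqxx !mul1r addr0 fl.
  rewrite (f'E (Ordinal lt_n1)) /= [x * (_ * _)]mulrA -exprS prednK // => <-.
  by rewrite addrC addKr.
have cw'n : c * w' n.-1 = c * (x ^+ n * s' - c * (x ^+ l.-1 * s)).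
  by case: (posnP n) => [n0|/w'n -> //]; rewrite n0_c // !mul0r.
split.
  have := sum_Gd s s'; rewrite [LHS](_ : _ = \sum_(i < l) ((- x) ^+ i *
      ((if (0 < i)%N then w i.-1 else 0) + x * w i) +
      (- x) ^+ i * (c * ((i.+1 == l)%:R * w' n.-1)))); last first.
    apply: eq_bigr => i _; rewrite -mulrDr -e3 /Gd -fE.
    by under eq_bigr do rewrite -f'E; ring.
  rewrite big_split /= alternating_telescope l_gt0 wl sum_last.
  rewrite [c * _ * _]mulrAC cw'n => eq_s.
  transitivity (((\sum_(i < l) (- x ^+ 2) ^+ i * dd 0 i) * s + bilin (- x) x * s') +
      ((- x ^+ 2) ^+ l * s + c ^+ 2 * (- x ^+ 2) ^+ l.-1 * s -
       c * (- x) ^+ l.-1 * x ^+ n * s')); first by rewrite /char_d /char_b; ring.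
  by rewrite -eq_s !split_power; ring.
have := sum_Ga s s'; rewrite [LHS](_ : _ = \sum_(i < n) ((- x) ^+ i *
    ((if (0 < i)%N then w' i.-1 else 0) + x * w' i))); last first.
  apply: eq_bigr => i _; rewrite -e4 /Ga -f'E.
  by under eq_bigr do rewrite -fE; ring.
rewrite alternating_telescope => eq_s'.
transitivity ((bilin x (- x) * s + (\sum_(i < n) (- x ^+ 2) ^+ i * aa 0 i) * s') +
  ((- x ^+ 2) ^+ n * s' - c * (- x) ^+ n * x ^+ l.-1 * s)).
  by rewrite /char_b' /char_a; ring.
rewrite -eq_s' !split_power; case: (posnP n) => [n0|n_gt0].
  by rewrite /s' n0_c // n0 /=; ring.
by rewrite w'n //; ring.
Qed.

(** The solution [w] of [g = (J^T + x) w], where [J] is the nilpotent Jordan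
    block. *)
Fixpoint back_subst (g : nat -> C) k : C :=
  if k is k'.+1 then (g k - back_subst g k') / x else g 0%N / x.

Lemma back_substP g k :
  g k = (if (0 < k)%N then back_subst g k.-1 else 0) + x * back_subst g k.
Proof.
case: k => [|k] /=; first by rewrite add0r mulrCA divff ?mulr1.
by rewrite mulrCA divff // mulr1 addrC subrK.
Qed.

Definition ext k (g : 'I_k -> C) (i : nat) : C := if insub i is Some j then g j else 0.

Lemma extE k (g : 'I_k -> C) (i : 'I_k) : ext g i = g i.
Proof. by rewrite /ext valK. Qed.

(** The third and fourth blocks of rows are solved for [w] and [w']; the two
    reduced equations say that their last entries are those required by the
    first and second blocks. *)
Lemma reduced_eigen_eqs s s' : reduced_eqs s s' ->
  exists w w', eigen_eqs (fun k => x ^+ k * s) (fun k => x ^+ k * s') w w'.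
Proof.
move=> [eq_s eq_s']; pose f k := x ^+ k * s; pose f' k := x ^+ k * s'.
pose w' := back_subst (ext (Ga f f')).
pose W := w' n.-1.
pose w := back_subst (ext (fun i => Gd f f' i - c * ((i.+1 == l)%:R * W))).
have w'E (i : 'I_n) : Ga f f' i = (if (0 < i)%N then w' i.-1 else 0) + x * w' i.
  by rewrite -back_substP extE.
have wE (i : 'I_l) : Gd f f' i - c * ((i.+1 == l)%:R * W) =
    (if (0 < i)%N then w i.-1 else 0) + x * w i.
  by rewrite -back_substP extE.
have w'n : (0 < n)%N -> W = x ^+ n * s' - c * (x ^+ l.-1 * s).
  move=> n_gt0; have := sum_Ga s s'.
  under eq_bigr do rewrite w'E; rewrite alternating_telescope n_gt0 -/W => eqW.
  apply: (mulfI (xn0 n)); apply: oppr_inj; rewrite -mulNr eqW.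
  apply/eqP; rewrite -subr_eq0; apply/eqP.
  rewrite -[RHS]eq_s' /char_b' /char_a split_power.
  by ring.
have cw'n : c * W = c * (x ^+ n * s' - c * (x ^+ l.-1 * s)).
  by case: (posnP n) => [n0|/w'n -> //]; rewrite n0_c // !mul0r.
have wl : w l.-1 = x ^+ l * s.
  have := sum_Gd s s'; rewrite [LHS](_ : _ = \sum_(i < l) ((- x) ^+ i *
      ((if (0 < i)%N then w i.-1 else 0) + x * w i) +
      (- x) ^+ i * (c * ((i.+1 == l)%:R * W)))); last first.
    by apply: eq_bigr => i _; rewrite -mulrDr -wE subrK.
  rewrite big_split /= alternating_telescope l_gt0 sum_last mulrAC cw'n => eqw.
  apply: (mulfI (xn0 l)); apply: oppr_inj; rewrite -mulNr.
  move/(canRL (addrK _)): eqw => ->.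
  apply/eqP; rewrite -subr_eq0; apply/eqP.
  rewrite -[RHS]eq_s /char_d /char_b !split_power.
  by ring.
exists w, w'; split=> i.
- case: ltnP => [lt_i|le_l]; first by rewrite (ltn_eqF lt_i) mul0r addr0 exprS mulrA.
  have eq_l : i.+1 = l by apply/eqP; rewrite eqn_leq ltn_ord.
  by rewrite eq_l eqxx mul1r add0r wl mulrA -exprS eq_l.
- have n_gt0 : (0 < n)%N by exact: leq_ltn_trans (ltn_ord i).
  case: ltnP => [lt_i|le_n].
    by rewrite (ltn_eqF lt_i) !mul0r mulr0 add0r addr0 exprS mulrA.
  have eq_n : i.+1 = n by apply/eqP; rewrite eqn_leq ltn_ord.
  by rewrite eq_n eqxx !mul1r addr0 -/W w'n // [RHS]mulrA -exprS eq_n addrC subrK.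
- by have := wE i; rewrite /Gd -/W /f /f' => h; rewrite addrAC h addrC addKr.
- by have := w'E i; rewrite /Ga /f /f' => ->; rewrite addrC addKr.
Qed.

(** The two reduced equations have a nonzero solution if and only if their
    determinant vanishes. *)
Lemma slice_shape_eigenvalue :
  (exists2 v : 'cV_((l + n) + (l + n)), v != 0 & Y *m v = x *: v) <->
  char_d * char_a = char_b * char_b'.
Proof.
split=> [[v v_neq0]|eq_det].
  have [f def_f] := colfE (usubmx (usubmx v)).
  have [f' def_f'] := colfE (dsubmx (usubmx v)).
  have [w def_w] := colfE (usubmx (dsubmx v)).
  have [w' def_w'] := colfE (dsubmx (dsubmx v)).
  have def_v : v = col_mx (col_mx (colf l f) (colf n f')) (col_mx (colf l w) (colf n w')).
    by rewrite -def_f -def_f' -def_w -def_w' !vsubmxK.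
  rewrite def_v => /eigen_eqsP eqs.
  have := eigen_eqs_reduced eqs; set s := f 0%N; set s' := if _ then _ else _.
  move=> [eq_s eq_s']; case: (altP (s =P 0)) => [s0|s_neq0]; last first.
    apply: (mulIf s_neq0); apply/eqP; rewrite -subr_eq0; apply/eqP.
    transitivity (char_a * (char_d * s + char_b * s') -
      char_b * (char_b' * s + char_a * s')); first by ring.
    by rewrite eq_s eq_s' !mulr0 subrr.
  case: (altP (s' =P 0)) => [s'0|s'_neq0]; last first.
    apply: (mulIf s'_neq0); apply/eqP; rewrite -subr_eq0; apply/eqP.
    transitivity (char_d * (char_b' * s + char_a * s') -
      char_b' * (char_d * s + char_b * s')); first by ring.
    by rewrite eq_s eq_s' !mulr0 subrr.
  case/eqP: v_neq0; rewrite def_v; have [fE f'E] := eigen_eqs_powers eqs.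
  have f0 (i : 'I_l) : f i = 0 by rewrite fE -/s s0 mulr0.
  have f'0 (i : 'I_n) : f' i = 0.
    by move: s'0; rewrite f'E /s' (leq_ltn_trans _ (ltn_ord i)) // => ->; rewrite mulr0.
  case: eqs => _ _ e3 e4.
  have w'0 (i : 'I_n) : w' i = 0.
    apply: (chain_eq0 (k := n)) => // j; rewrite -e4 f'0 mulr0 big1 => [|p _].
      by rewrite addr0 sub0r addrN.
    by rewrite f0 mulr0.
  have cw'n : c * w' n.-1 = 0.
    case: (posnP n) => [n0|n_gt0]; first by rewrite n0_c ?mul0r.
    have lt_n1 : (n.-1 < n)%N by rewrite ltn_predL.
    by rewrite (w'0 (Ordinal lt_n1)) mulr0.
  have w0 (i : 'I_l) : w i = 0.
    apply: (chain_eq0 (k := l)) => // j; rewrite -e3 f0 mulr0 big1 => [|q _].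
      by rewrite mulrCA cw'n mulr0 subr0 addr0 sub0r addrN.
    by rewrite f'0 mulr0.
  have zero k (g : nat -> C) : (forall i : 'I_k, g i = 0) -> colf k g = 0 :> 'cV[C]_k.
    by move=> g0; apply/colP => i; rewrite !mxE.
  by rewrite !zero // !col_mx0.
have [s [s' [neq0 eqs]]] : exists s s', ((s != 0) || (s' != 0)) /\ reduced_eqs s s'.
  have [/andP[/eqP d0 /eqP b0]|] := boolP ((char_d == 0) && (char_b == 0)).
    have [/andP[/eqP b'0 /eqP a0]|] := boolP ((char_b' == 0) && (char_a == 0)).
      by exists 1, 0; rewrite oner_eq0 /reduced_eqs d0 b0 b'0 a0 !mul0r addr0.
    rewrite negb_and => neq0; exists char_a, (- char_b'); split.
      by rewrite oppr_eq0 orbC.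
    by rewrite /reduced_eqs d0 b0 !mul0r addr0; split=> //; ring.
  rewrite negb_and => neq0; exists (- char_b), char_d; split.
    by rewrite oppr_eq0 orbC.
  split; first by ring.
  by rewrite mulrN [_ * char_b]mulrC -eq_det; ring.
have [w [w' /eigen_eqsP eqv]] := reduced_eigen_eqs eqs.
set v := col_mx _ _ in eqv; exists v => //; apply/negP => /eqP v0.
have /colP p0 : colf l (fun k => x ^+ k * s) = 0.
  rewrite -[LHS](col_mxKu _ (colf n (fun k => x ^+ k * s'))).
  rewrite -[X in usubmx X](col_mxKu _ (col_mx (colf l w) (colf n w'))).
  by rewrite -/v v0 !linear0.
have /colP p'0 : colf n (fun k => x ^+ k * s') = 0.
  rewrite -[LHS](col_mxKd (colf l (fun k => x ^+ k * s))).
  rewrite -[X in dsubmx X](col_mxKu _ (col_mx (colf l w) (colf n w'))).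
  by rewrite -/v v0 !linear0.
have s0 : s = 0 by have := p0 (Ordinal l_gt0); rewrite !mxE mul1r.
suff s'0 : s' = 0 by rewrite s0 s'0 eqxx in neq0.
case: (posnP n) => [n0|n_gt0]; last by have := p'0 (Ordinal n_gt0); rewrite !mxE mul1r.
have [_] := eqs; rewrite s0 mulr0 add0r /char_a big1 ?addr0 => [|i _]; last first.
  by have := ltn_ord i; rewrite {2}n0.
move=> /eqP; rewrite mulf_eq0 split_power mulf_eq0 (negPf (xn0 _)).
by rewrite (negPf (expf_neq0 _ x_neq0)) => /eqP.
Qed.

End Eigen.
End Slice.

(** * The equation of the fiber *)

Section SlicePolynomials.
Variables (R : realType) (l n : nat).
Local Notation C := R[i].
Hypotheses (l_gt0 : (0 < l)%N) (n_le : (n <= l)%N).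
Implicit Types (a y z : 'rV[C]_n) (d : 'rV[C]_l).

(** The multiple of [slice_E] that occurs in the slice. *)
Definition zeta z : C := if (n < l)%N then 0 else last_entry z.

Definition slice_of a y z d : 'M[C]_((l + n) + (l + n)) :=
  slice_shape (\row_i (d 0 (rev_ord i) + (i.+1 == l)%:R * zeta z ^+ 2))
    (\row_i a 0 (rev_ord i)) (slice_offdiag l y z) (zeta z).

Lemma slice_ofP Y : slice l n Y <-> exists a y z d, Y = slice_of a y z d.
Proof.
suff sliceE a y z d : slice_of a y z d =
    if (n < l)%N then slice_lt a y z d else slice_eq a y z d.
  by split=> -[a [y [z [d ->]]]]; exists a, y, z, d; rewrite sliceE.
rewrite /slice_of /zeta /slice_lt /slice_eq /nilp_X /slice_M /slice_E /slice_shape.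
case: ifP => _.
  rewrite !add_block_mx !addr0 !add0r !scale0r trmx0 oppr0.
  congr (block_mx _ _ (block_mx (diag_mx _) _ _ _) _).
  by apply/rowP => i; rewrite !mxE expr0n mulr0 addr0.
rewrite tr_block_mx opp_block_mx !trmx0 !oppr0 !scale_block_mx !scaler0.
rewrite !(add_block_mx, addr0, add0r) scalerN [(_ *: corner R n l)^T]linearZ /=.
congr (block_mx _ _ (block_mx _ _ _ _) _); apply/matrixP => i j; rewrite !mxE.
case: (eqVneq i j) => [->|ne_ij]; rewrite ?mulr1n ?mulr0n.
  by rewrite andbb mulrC.
rewrite add0r; case: eqP => [eq_i|_]; last by rewrite mulr0.
case: eqP => [eq_j|_]; last by rewrite mulr0.
by case/eqP: ne_ij; apply: val_inj; apply: succn_inj; rewrite eq_i eq_j.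
Qed.

Lemma slice_of_sp a y z d : sp (slice_of a y z d).
Proof.
set P := block_mx (jordan_nil R l) 0 (zeta z *: corner R n l) (jordan_nil R n).
exists P, (block_mx (corner R l l) 0 0 (corner R n n)), (block_mx
  (diag_mx (\row_i (d 0 (rev_ord i) + (i.+1 == l)%:R * zeta z ^+ 2)))
  (slice_offdiag l y z) (slice_offdiag l y z)^T (diag_mx (\row_i a 0 (rev_ord i)))).
have tr_corner k : (corner R k k)^T = corner R k k.
  by apply/matrixP => i j; rewrite !mxE andbC.
split; first by rewrite tr_block_mx !trmx0 !tr_corner.
  by rewrite tr_block_mx !tr_diag_mx trmxK.
by rewrite /slice_of /slice_shape /P tr_block_mx opp_block_mx trmx0 oppr0.
Qed.

Lemma zeta_n0 z : n = 0%N -> zeta z = 0.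
Proof. by move=> n0; rewrite /zeta ifT // n0. Qed.

Definition poly_a a := monic_of (\row_i ((-1) ^+ (n + i) * a 0 (rev_ord i))).
Definition poly_d d (c : C) := monic_of
  (\row_i ((-1) ^+ (l + i) * (d 0 (rev_ord i) + (i.+1 == l)%:R * (2 * c ^+ 2)))).
Definition poly_b y z : {poly C} :=
  rVpoly y + 'X^n * rVpoly (\row_j ((-1) ^+ j.+1 * z 0 j)).

Lemma size_poly_b y z : (size (poly_b y z) <= n + n)%N.
Proof.
apply: leq_trans (size_polyD _ _) _; rewrite geq_max.
rewrite (leq_trans (size_poly _ _)) ?leq_addr //=.
apply: leq_trans (size_polyMleq _ _) _; rewrite size_polyXn /= leq_add2l.
exact: size_poly.
Qed.

Lemma coef_poly_b y z i : (poly_b y z)`_i =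
  if (i < n)%N then (rVpoly y)`_i else (rVpoly (\row_j ((-1) ^+ j.+1 * z 0 j)))`_(i - n).
Proof.
rewrite coefD coefXnM; case: ltnP => [_|le_ni]; first by rewrite addr0.
by rewrite [(rVpoly y)`__]nth_default ?add0r // (leq_trans (size_poly _ _)).
Qed.

Lemma sign_cancel k i (b : C) : (-1) ^+ k * ((-1) ^+ (k + i) * b) = (-1) ^+ i * b.
Proof. by rewrite mulrA -exprD addnA addnn -signr_odd oddD odd_double signr_odd. Qed.

Lemma char_a_horner a x :
  char_a (\row_i a 0 (rev_ord i)) x = (-1) ^+ n * (poly_a a).[x ^+ 2].
Proof.
rewrite /char_a horner_monic_of mulrDr [(- x ^+ 2) ^+ n]exprNn; congr (_ + _).
rewrite mulr_sumr; apply: eq_bigr => i _.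
rewrite !mxE -mulrA sign_cancel [(- x ^+ 2) ^+ i]exprNn.
by ring.
Qed.

(** The coefficient [d_1] is shifted by [2 * c ^+ 2]: one [c ^+ 2] is the
    correction of the diagonal of [M'], the other comes from the product of the
    two entries [c] of [Y] outside [M']. *)
Lemma char_d_horner d x c :
  char_d (\row_i (d 0 (rev_ord i) + (i.+1 == l)%:R * c ^+ 2)) c x =
  (-1) ^+ l * (poly_d d c).[x ^+ 2].
Proof.
rewrite /char_d horner_monic_of mulrDr -addrA [(- x ^+ 2) ^+ l]exprNn; congr (_ + _).
rewrite mulr_sumr; have lt_l1 : (l.-1 < l)%N by rewrite ltn_predL.
have -> : c ^+ 2 * (- x ^+ 2) ^+ l.-1 =
    \sum_(i < l) (i.+1 == l)%:R * (c ^+ 2 * (- x ^+ 2) ^+ i).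
  rewrite (bigD1 (Ordinal lt_l1)) //= prednK // eqxx big1 ?addr0 ?mul1r // => i ne_i.
  case: eqP => [eq_l|_]; last by rewrite mul0r.
  by case/eqP: ne_i; apply: val_inj; have := congr1 predn eq_l.
rewrite -big_split; apply: eq_bigr => i _ /=; rewrite !mxE -[in RHS]mulrA sign_cancel.
by rewrite [(- x ^+ 2) ^+ i]exprNn; ring.
Qed.

Lemma bilin_slice_offdiag y z s t :
  bilin (slice_offdiag l y z) s t = \sum_(q < n) y 0 q * t ^+ q +
    \sum_(j < n) (if (j.+1 < l)%N then s ^+ j.+1 * t ^+ n.-1 * z 0 j else 0).
Proof.
case: l l_gt0 n_le => // l' _ n_le'.
rewrite /bilin big_ord_recl; congr (_ + _).
  by apply: eq_bigr => q _; rewrite mxE /= expr0 mul1r.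
transitivity (\sum_(p < l') \sum_(j < n)
    (p == j :> nat)%:R * (s ^+ p.+1 * t ^+ n.-1 * z 0 j)).
  apply: eq_bigr => p _.
  transitivity (\sum_(q < n) \sum_(j < n) (q.+1 == n)%:R *
      ((p == j :> nat)%:R * (s ^+ p.+1 * t ^+ q * z 0 j))).
    apply: eq_bigr => q _; rewrite mxE /= mulr_sumr mulr_suml big_mkcond.
    apply: eq_bigr => j _; rewrite /bump /= add1n eqSS.
    case: eqP => _ /=; last by rewrite mul0r mulr0.
    by case: eqP => _ /=; [ring | rewrite !mul0r].
  rewrite exchange_big; apply: eq_bigr => j _ /=.
  have n_gt0 : (0 < n)%N by exact: leq_ltn_trans (ltn_ord j).
  have lt_n1 : (n.-1 < n)%N by rewrite ltn_predL.
  rewrite (bigD1 (Ordinal lt_n1)) //= prednK // eqxx mul1r big1 ?addr0 // => q ne_q.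
  case: eqP => [eq_n|_]; last by rewrite mul0r.
  by case/eqP: ne_q; apply: val_inj; have := congr1 predn eq_n.
rewrite exchange_big; apply: eq_bigr => j _ /=; rewrite ltnS.
rewrite -(sum_delta l' j (fun p => s ^+ p.+1 * t ^+ n.-1 * z 0 j)).
by apply: eq_bigr => p _; rewrite eq_sym.
Qed.

(** When [l = n] the term in [c] supplies the coefficient [z_n] missing from
    [slice_offdiag]. *)
Lemma char_b_horner y z t :
  bilin (slice_offdiag l y z) (- t) t - zeta z * (- t) ^+ l.-1 * t ^+ n =
  (poly_b y z).[t].
Proof.
rewrite bilin_slice_offdiag hornerD hornerM hornerXn !horner_rVpoly -addrA.
congr (_ + _).
have -> : - (zeta z * (- t) ^+ l.-1 * t ^+ n) =
    \sum_(j < n) (if (j.+1 < l)%N then 0 else (- t) ^+ j.+1 * t ^+ n.-1 * z 0 j).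
  rewrite /zeta; case: ltnP => [lt_nl|le_ln].
    rewrite !mul0r oppr0 big1 // => j _.
    by rewrite (leq_ltn_trans _ lt_nl).
  have eq_nl : n = l by apply/eqP; rewrite eqn_leq n_le.
  rewrite /last_entry !mulr_suml -sumrN big_mkcond; apply: eq_bigr => j _.
  have n_gt0 : (0 < n)%N by exact: leq_ltn_trans (ltn_ord j).
  rewrite -eq_nl; case: eqP => [eq_j|/eqP ne_j]; last first.
    by rewrite ltn_neqAle ne_j ltn_ord.
  rewrite eq_j ltnn; have powS (u : C) : u ^+ n = u * u ^+ n.-1 by rewrite -exprS prednK.
  by rewrite !powS; ring.
rewrite -big_split mulr_sumr; apply: eq_bigr => j _ /=; rewrite mxE.
have n_gt0 : (0 < n)%N by exact: leq_ltn_trans (ltn_ord j).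
have powS (u : C) : u ^+ n = u * u ^+ n.-1 by rewrite -exprS prednK.
rewrite [(- t) ^+ _]exprNn powS !exprS.
by case: ifP => _; rewrite ?addr0 ?add0r; ring.
Qed.

End SlicePolynomials.

Lemma eval_surface (R : realType) (t : seq R[i]) (U V : {poly R[i]}) :
  eval_curve U V (surface_eqn t) =
  \prod_(c <- t) ('X - c%:P) + U ^+ 2 + 'X * V ^+ 2.
Proof.
rewrite /surface_eqn !eval_curveD eval_curveM !eval_curveX.
rewrite eval_curve_u eval_curve_v eval_curve_z.
congr (_ + _ + _); elim: t => [|c t IH]; first by rewrite !big_nil eval_curve1.
rewrite !big_cons eval_curveM IH eval_curveB eval_curveZ eval_curve1.
by rewrite eval_curve_z alg_polyC.
Qed.

Section FiberEquation.
Variables (R : realType) (l n : nat).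
Local Notation C := R[i].
Hypotheses (l_gt0 : (0 < l)%N) (n_le : (n <= l)%N).
Variable t : seq C.
Hypotheses (size_t : size t = (l + n)%N) (uniq_t : uniq t) (t_neq0 : 0 \notin t).
Implicit Types (a y z : 'rV[C]_n) (d : 'rV[C]_l) (U V : {poly C}).

(** The squares of these constants are [(-1) ^+ (l + n)] and its opposite, which
    turns [B_0^2 - z B_1^2] into [U^2 + z V^2] up to sign. *)
Definition scale_u : C := 'i ^+ (l + n).
Definition scale_v : C := 'i ^+ (l + n).+1.

Lemma scale_u2 : scale_u ^+ 2 = (-1) ^+ (l + n).
Proof. by rewrite /scale_u -exprM mulnC exprM sqrCi. Qed.

Lemma scale_v2 : scale_v ^+ 2 = - (-1) ^+ (l + n).
Proof. by rewrite /scale_v -exprM mulnC exprM sqrCi exprS mulN1r. Qed.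

Definition poly_u y z := scale_u *: even_poly (poly_b y z).
Definition poly_v y z := scale_v *: odd_poly (poly_b y z).

Lemma size_poly_u y z : (size (poly_u y z) <= n)%N.
Proof.
apply: leq_trans (size_scale_leq _ _) _; apply: leq_trans (size_even_poly _) _.
by rewrite uphalfE leq_half_double ltnS -addnn size_poly_b.
Qed.

Lemma size_poly_v y z : (size (poly_v y z) <= n)%N.
Proof.
apply: leq_trans (size_scale_leq _ _) _; apply: leq_trans (size_odd_poly _) _.
by rewrite leq_half_double -addnn leqW ?size_poly_b.
Qed.

Lemma poly_b_norm y z x : (poly_b y z).[x] * (poly_b y z).[- x] =
  (-1) ^+ (l + n) * ((poly_u y z) ^+ 2 + 'X * (poly_v y z) ^+ 2).[x ^+ 2].
Proof.
set b := poly_b y z; rewrite -{1 2}(poly_even_odd b).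
rewrite !(hornerD, hornerM, hornerX, horner_comp, horner_exp, hornerXn, hornerZ).
rewrite -/b !mulrNN -![x * x]expr2.
set e := (even_poly b).[_]; set o := (odd_poly b).[_].
transitivity ((-1) ^+ (l + n) * (scale_u ^+ 2 * e ^+ 2 + scale_v ^+ 2 * x ^+ 2 * o ^+ 2)).
  rewrite scale_u2 scale_v2.
  transitivity ((-1) ^+ (l + n) * (-1) ^+ (l + n) * (e ^+ 2 - x ^+ 2 * o ^+ 2)).
    by rewrite -exprD addnn -signr_odd odd_double expr0 mul1r; ring.
  by ring.
by ring.
Qed.

Lemma surface_monic U V : (size U <= n)%N -> (size V <= n)%N ->
  eval_curve U V (surface_eqn t) \is monic /\
  size (eval_curve U V (surface_eqn t)) = (l + n).+1.
Proof.
move=> szU szV; rewrite eval_surface -addrA.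
have szP : size (\prod_(c <- t) ('X - c%:P)) = (l + n).+1.
  by rewrite size_prod_XsubC size_t.
have szUV : (size (U ^+ 2 + 'X * V ^+ 2)%R < (l + n).+1)%N.
  rewrite ltnS; apply: leq_trans (size_polyD _ _) _; rewrite geq_max; apply/andP; split.
    apply: leq_trans (size_polyMleq _ _) _; apply: leq_trans (leq_pred _) _.
    by apply: leq_add => //; exact: leq_trans n_le.
  have [->|V_neq0] := eqVneq V 0; first by rewrite expr0n mulr0 size_poly0.
  rewrite mulrC size_mulX ?expf_neq0 // -[X in (_ <= X)%N]prednK ?addn_gt0 ?l_gt0 //.
  rewrite ltnS.
  apply: leq_trans (size_polyMleq _ _) _; rewrite -!subn1 leq_sub2r //.
  by apply: leq_add => //; exact: leq_trans n_le.
split; last by rewrite size_polyDl szP.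
by rewrite monicE lead_coefDl ?szP // -monicE monic_prod_XsubC.
Qed.

(** Both sides are monic of degree [l + n], so they are equal if and only if they
    agree at the [l + n] points of [t]; at [x ^+ 2] this means that [x] is an
    eigenvalue. *)
Lemma fiber_polys a y z d : adjoint_quotient (slice_of a y z d) t <->
  poly_a a * poly_d d (zeta l z) =
  eval_curve (poly_u y z) (poly_v y z) (surface_eqn t).
Proof.
set U := poly_u y z; set V := poly_v y z; set Y := slice_of a y z d.
have [monS szS] := surface_monic (size_poly_u y z) (size_poly_v y z).
have eigP x : x ^+ 2 \in t ->
    (exists2 v : 'cV_((l + n) + (l + n)), v != 0 & Y *m v = x *: v) <->
    (poly_a a * poly_d d (zeta l z)).[x ^+ 2] =
    (eval_curve U V (surface_eqn t)).[x ^+ 2].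
  move=> xt; have x_neq0 : x != 0.
    by apply: contraNneq t_neq0 => x0; rewrite x0 expr0n in xt.
  rewrite /Y /slice_of slice_shape_eigenvalue //; last exact: zeta_n0.
  have Pt : (\prod_(c <- t) ('X - c%:P)).[x ^+ 2] = 0.
    by apply/rootP; rewrite root_prod_XsubC.
  rewrite eval_surface -addrA hornerD Pt add0r.
  rewrite char_a_horner char_d_horner // /char_b char_b_horner //.
  have -> : char_b' (slice_offdiag l y z) (zeta l z) x = (poly_b y z).[- x].
    by rewrite -(char_b_horner l_gt0 n_le) opprK /char_b'; ring.
  rewrite poly_b_norm -/U -/V hornerM.
  set A := (poly_a a).[_]; set D := (poly_d _ _).[_]; set S := (_ + _).[_].
  have -> : (-1) ^+ l * D * ((-1) ^+ n * A) = (-1) ^+ (l + n) * (A * D).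
    by rewrite exprD; ring.
  by split=> [|->] //; apply: mulfI; rewrite signr_eq0.
have szAD : size (poly_a a * poly_d d (zeta l z)) = (l + n).+1.
  rewrite size_monicM ?monic_of_monic ?monic_neq0 ?monic_of_monic //.
  by rewrite !size_monic_of addnS addSn addnC.
split=> [Yt|eq_AD]; last first.
  apply: eigenvectors_adjoint_quotient => //; first exact: slice_of_sp.
  by move=> x xt; apply/(eigP x xt); rewrite eq_AD.
apply/eqP; rewrite -subr_eq0; apply: contraTT (leqnn (l + n)) => neq0.
have szB : (size (poly_a a * poly_d d (zeta l z) -
    eval_curve U V (surface_eqn t))%R <= l + n)%N.
  by apply: size_monicB => //; rewrite rpredM ?monic_of_monic.
rewrite -ltnNge; apply: leq_trans szB; rewrite -{1}size_t.
apply: max_poly_roots neq0 _ uniq_t; apply/allP => c ct; apply/rootP.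
rewrite hornerD hornerN -(sqrtCK c); apply/eqP; rewrite subr_eq0; apply/eqP.
by apply/eigP; [|apply: adjoint_quotient_eigenvector Yt _]; rewrite sqrtCK.
Qed.

End FiberEquation.

(** * Coordinates on the slice *)

Section SliceCoordinates.
Variables (R : realType) (l n : nat).
Local Notation C := R[i].
Let M : normedModType C := 'M[C]_((l + n) + (l + n)).
Hypotheses (l_gt0 : (0 < l)%N) (n_le : (n <= l)%N).
Implicit Types (Y : M) (a y z : 'rV[C]_n) (d : 'rV[C]_l) (A U V : {poly C}).

Definition coord_a Y : 'rV[C]_n := \row_k drsubmx (dlsubmx Y) (rev_ord k) (rev_ord k).
Definition coord_y Y : 'rV[C]_n := \row_k entry (ursubmx (dlsubmx Y)) 0 k.
Definition coord_z Y : 'rV[C]_n := \row_k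
  (if (k.+1 < l)%N then entry (ursubmx (dlsubmx Y)) k.+1 n.-1
   else entry (dlsubmx (ulsubmx Y)) n.-1 l.-1).

Lemma coord_a_slice a y z d : coord_a (slice_of a y z d) = a.
Proof.
apply/rowP => k; rewrite mxE block_mxKdl block_mxKdr mxE eqxx mulr1n mxE.
by rewrite rev_ordK.
Qed.

Lemma coord_y_slice a y z d : coord_y (slice_of a y z d) = y.
Proof.
apply/rowP => k; rewrite mxE block_mxKdl block_mxKur.
by rewrite (entryE _ l_gt0 (ltn_ord k)) mxE /=; congr (y 0 _); apply: val_inj.
Qed.

Lemma coord_z_slice a y z d : coord_z (slice_of a y z d) = z.
Proof.
apply/rowP => k; have n_gt0 : (0 < n)%N by exact: leq_ltn_trans (ltn_ord k).
have lt_n1 : (n.-1 < n)%N by rewrite ltn_predL.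
have lt_l1 : (l.-1 < l)%N by rewrite ltn_predL.
rewrite mxE block_mxKdl block_mxKur block_mxKul block_mxKdl; case: ltnP => [lt_kl|le_lk].
  rewrite (entryE _ lt_kl lt_n1) mxE /= (big_pred1 k) // => j.
  by rewrite prednK // eqxx andbT eqSS eq_sym.
have eq_k : k.+1 = n by apply/eqP; rewrite eqn_leq ltn_ord (leq_trans n_le).
have eq_l : n = l by apply/eqP; rewrite eqn_leq n_le -eq_k.
rewrite (entryE _ lt_n1 lt_l1) !mxE /= !prednK // !eqxx mulr1.
rewrite /zeta {1}eq_l ltnn /last_entry (big_pred1 k) // => j.
by rewrite -[X in (_ == X) = _]eq_k eqSS.
Qed.

Definition coord_A Y := poly_a (coord_a Y).
Definition coord_U Y := poly_u l (coord_y Y) (coord_z Y).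
Definition coord_V Y := poly_v l (coord_y Y) (coord_z Y).

Let differentiable_coord_y Y : differentiable coord_y Y.
Proof.
apply/differentiable_mxP => i k; under eq_fun do rewrite mxE.
apply: differentiable_entry; apply/differentiable_mxP => p q.
by under eq_fun do rewrite !mxE; exact: differentiable_coord.
Qed.

Let differentiable_coord_z Y : differentiable coord_z Y.
Proof.
apply/differentiable_mxP => i k; under eq_fun do rewrite mxE.
by case: (k.+1 < l)%N; apply: differentiable_entry; apply/differentiable_mxP => p q;
  under eq_fun do rewrite !mxE; exact: differentiable_coord.
Qed.

Let differentiable_coord_a Y : differentiable coord_a Y.
Proof.
apply/differentiable_mxP => i k.
by under eq_fun do rewrite !mxE; exact: differentiable_coord.
Qed.

Let differentiable_poly_b Y :
  differentiable_poly Y (fun X => poly_b (coord_y X) (coord_z X)).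
Proof.
apply: differentiable_polyD.
  exact: (differentiable_rVpoly (differentiable_coord_y Y)).
apply: differentiable_polyM; first exact: differentiable_polyC.
apply: differentiable_rVpoly; apply/differentiable_mxP => i j.
under eq_fun do rewrite mxE; apply: differentiable_mulf.
  exact: differentiable_cst.
by move/differentiable_mxP: (differentiable_coord_z Y); apply.
Qed.

Lemma differentiable_coord_U Y : differentiable_poly Y coord_U.
Proof.
move=> i; under eq_fun do rewrite coefZ coef_even_poly.
by apply: differentiable_mulf; [exact: differentiable_cst | exact: differentiable_poly_b].
Qed.

Lemma differentiable_coord_V Y : differentiable_poly Y coord_V.
Proof.
move=> i; under eq_fun do rewrite coefZ coef_odd_poly.
by apply: differentiable_mulf; [exact: differentiable_cst | exact: differentiable_poly_b].
Qed.

Lemma differentiable_coord_A Y : differentiable_poly Y coord_A.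
Proof.
apply: differentiable_polyD; first exact: differentiable_polyC.
apply: differentiable_rVpoly; apply/differentiable_mxP => i j.
under eq_fun do rewrite mxE; apply: differentiable_mulf.
  exact: differentiable_cst.
by move/differentiable_mxP: (differentiable_coord_a Y); apply.
Qed.

Variable t : seq C.
Hypotheses (size_t : size t = (l + n)%N) (uniq_t : uniq t) (t_neq0 : 0 \notin t).

Definition inv_b U V : {poly C} :=
  even_odd ((scale_u R l n)^-1 *: U) ((scale_v R l n)^-1 *: V).
Definition inv_y U V : 'rV[C]_n := \row_q (inv_b U V)`_q.
Definition inv_z U V : 'rV[C]_n := \row_j ((-1) ^+ j.+1 * (inv_b U V)`_(n + j)).
Definition inv_a A : 'rV[C]_n := \row_k ((-1) ^+ (n + rev_ord k) * A`_(rev_ord k)).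
Definition inv_d (c : C) (D : {poly C}) : 'rV[C]_l := \row_k
  ((-1) ^+ (l + rev_ord k) * D`_(rev_ord k) - ((rev_ord k).+1 == l)%:R * (2 * c ^+ 2)).
(** [D] is the quotient of [P + U^2 + z V^2] by [A]. *)
Definition inv_slice A U V : M :=
  slice_of (inv_a A) (inv_y U V) (inv_z U V)
    (inv_d (zeta l (inv_z U V)) (eval_curve U V (surface_eqn t) %/ A)).

Let signMK k (b : C) : (-1) ^+ k * ((-1) ^+ k * b) = b.
Proof. by rewrite mulrA -exprD addnn -signr_odd odd_double mul1r. Qed.

Lemma scale_u_neq0 : scale_u R l n != 0.
Proof. by rewrite expf_neq0 // neq0Ci. Qed.

Lemma scale_v_neq0 : scale_v R l n != 0.
Proof. by rewrite expf_neq0 // neq0Ci. Qed.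

Lemma inv_aK A : A \is monic -> size A = n.+1 -> poly_a (inv_a A) = A.
Proof.
move=> monA szA; rewrite -[RHS](monic_ofK monA szA) /poly_a; congr monic_of.
by apply/rowP => i; rewrite !mxE rev_ordK signMK.
Qed.

Lemma poly_aK a : inv_a (poly_a a) = a.
Proof.
by apply/rowP => i; rewrite !mxE coef_monic_of mxE signMK rev_ordK.
Qed.

Lemma inv_dK c D : D \is monic -> size D = l.+1 -> poly_d (inv_d c D) c = D.
Proof.
move=> monD szD; rewrite -[RHS](monic_ofK monD szD) /poly_d; congr monic_of.
by apply/rowP => i; rewrite !mxE rev_ordK subrK signMK.
Qed.

Lemma poly_dK c d : inv_d c (poly_d d c) = d.
Proof.
by apply/rowP => i; rewrite !mxE coef_monic_of mxE signMK rev_ordK addrK.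
Qed.

Lemma inv_bK U V : (size U <= n)%N -> (size V <= n)%N ->
  poly_b (inv_y U V) (inv_z U V) = inv_b U V.
Proof.
move=> szU szV; apply/polyP => i; rewrite coef_poly_b !coef_rVpoly.
case: ltnP => [lt_in|le_ni]; first by rewrite insubT mxE.
case: insubP => [j lt_j def_j|]; last first.
  rewrite -leqNgt leq_subRL // => le_2n; rewrite nth_default //.
  apply: leq_trans le_2n; apply: size_even_odd; exact: leq_trans (size_scale_leq _ _) _.
by rewrite !mxE signMK def_j subnKC.
Qed.

Lemma inv_UVK U V : (size U <= n)%N -> (size V <= n)%N ->
  poly_u l (inv_y U V) (inv_z U V) = U /\ poly_v l (inv_y U V) (inv_z U V) = V.
Proof.
move=> szU szV; rewrite /poly_u /poly_v inv_bK // /inv_b.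
rewrite even_poly_even_odd odd_poly_even_odd !scalerA.
by rewrite !mulfV ?scale_u_neq0 ?scale_v_neq0 // !scale1r.
Qed.

Lemma poly_uvK y z :
  inv_y (poly_u l y z) (poly_v l y z) = y /\ inv_z (poly_u l y z) (poly_v l y z) = z.
Proof.
have eq_b : inv_b (poly_u l y z) (poly_v l y z) = poly_b y z.
  rewrite /inv_b !scalerA !mulVf ?scale_u_neq0 ?scale_v_neq0 // !scale1r.
  exact: poly_even_odd.
split; apply/rowP => i; rewrite mxE eq_b coef_poly_b.
  by rewrite ltn_ord coef_rVpoly_ord.
by rewrite ltnNge leq_addr /= addKn coef_rVpoly_ord mxE signMK.
Qed.

Lemma inv_sliceK Y : slice_fiber l n t Y ->
  inv_slice (coord_A Y) (coord_U Y) (coord_V Y) = Y.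
Proof.
move=> [/slice_ofP [a [y [z [d ->]]]]].
move=> /(fiber_polys l_gt0 n_le size_t uniq_t t_neq0) eq_AD.
rewrite /inv_slice /coord_A /coord_U /coord_V coord_a_slice coord_y_slice coord_z_slice.
have [-> ->] := poly_uvK y z; rewrite -eq_AD mulrC mulpK ?poly_aK ?poly_dK //.
by rewrite monic_neq0 ?monic_of_monic.
Qed.

Lemma coord_A_dvd Y : slice_fiber l n t Y ->
  coord_A Y %| eval_curve (coord_U Y) (coord_V Y) (surface_eqn t).
Proof.
move=> [/slice_ofP [a [y [z [d ->]]]]].
move=> /(fiber_polys l_gt0 n_le size_t uniq_t t_neq0) eq_AD.
rewrite /coord_A /coord_U /coord_V coord_a_slice coord_y_slice coord_z_slice.
by rewrite -eq_AD dvdp_mulr.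
Qed.

Lemma inv_slice_fiber A U V : A \is monic -> size A = n.+1 ->
    (size U <= n)%N -> (size V <= n)%N -> A %| eval_curve U V (surface_eqn t) ->
  [/\ slice_fiber l n t (inv_slice A U V), coord_A (inv_slice A U V) = A,
      coord_U (inv_slice A U V) = U & coord_V (inv_slice A U V) = V].
Proof.
move=> monA szA szU szV dvdA; have [eU eV] := inv_UVK szU szV.
rewrite /coord_A /coord_U /coord_V coord_a_slice coord_y_slice coord_z_slice.
split=> //; last exact: inv_aK.
split.
  apply/slice_ofP; exists (inv_a A), (inv_y U V), (inv_z U V).
  by exists (inv_d (zeta l (inv_z U V)) (eval_curve U V (surface_eqn t) %/ A)).
apply/(fiber_polys l_gt0 n_le size_t uniq_t t_neq0); rewrite inv_aK // eU eV.
have [monS szS] := surface_monic l_gt0 n_le size_t szU szV.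
set S := eval_curve U V _ in monS szS dvdA *.
have defS : A * (S %/ A) = S by rewrite mulrC divpK.
have monD : S %/ A \is monic by rewrite -(monicMl _ monA) defS.
rewrite inv_dK //; have : size (A * (S %/ A)) = (l + n).+1 by rewrite defS.
rewrite size_monicM ?monic_neq0 // szA addSn /= => szAD.
by apply/eqP; rewrite -(eqn_add2l n) szAD addnS addnC.
Qed.

Lemma differentiable_inv_slice (q : chart_space R n) :
  differentiable (fun p => inv_slice (chart_A p) (chart_U p) (chart_V p)) q.
Proof.
have dB : differentiable_poly q (fun p => inv_b (chart_U p) (chart_V p)).
  move=> i; under eq_fun do rewrite coef_even_odd !coefZ.
  by case: (odd i); apply: differentiable_mulf; try exact: differentiable_cst;
    [exact: differentiable_chart_V | exact: differentiable_chart_U].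
have dy : differentiable (fun p => inv_y (chart_U p) (chart_V p)) q.
  by apply/differentiable_mxP => i k; under eq_fun do rewrite mxE; exact: dB.
have dz : differentiable (fun p => inv_z (chart_U p) (chart_V p)) q.
  apply/differentiable_mxP => i k; under eq_fun do rewrite mxE.
  by apply: differentiable_mulf; [exact: differentiable_cst | exact: dB].
have /differentiable_mxP dyE := dy; have /differentiable_mxP dzE := dz.
have dzeta : differentiable
    (fun p => zeta l (inv_z (chart_U p) (chart_V p)) : (C : numFieldType)) q.
  rewrite /zeta; case: (n < l)%N; first exact: differentiable_cst.
  by apply: differentiable_bigsum => i; exact: dzE.
have da : differentiable (fun p => inv_a (chart_A p)) q.
  apply/differentiable_mxP => i k; under eq_fun do rewrite mxE.
  apply: differentiable_mulf; [exact: differentiable_cst | exact: differentiable_chart_A].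
have dS : differentiable_poly q (fun p =>
    eval_curve (chart_U p) (chart_V p) (surface_eqn t) %/ chart_A p).
  apply: (differentiable_poly_divp (k := l.+1) (n := n)).
  - exact: chart_A_monic.
  - exact: size_chart_A.
  - move=> p; have [_ ->] := surface_monic l_gt0 n_le size_t
      (size_chart_U p) (size_chart_V p).
    by rewrite addnS addnC.
  - under eq_fun do rewrite eval_surface !expr2.
    have dU := @differentiable_chart_U R n q.
    have dV := @differentiable_chart_V R n q.
    apply: differentiable_polyD; first apply: differentiable_polyD.
    + exact: differentiable_polyC.
    + exact: differentiable_polyM.
    + apply: differentiable_polyM; first exact: differentiable_polyC.
      exact: differentiable_polyM.
  - exact: differentiable_chart_A.
have dd : differentiable (fun p => inv_d (zeta l (inv_z (chart_U p) (chart_V p)))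
    (eval_curve (chart_U p) (chart_V p) (surface_eqn t) %/ chart_A p)) q.
  apply/differentiable_mxP => i k; under eq_fun do rewrite mxE expr2.
  apply: differentiable_addf.
    by apply: differentiable_mulf; [exact: differentiable_cst | exact: dS].
  apply: differentiable_oppf; apply: differentiable_mulf.
    exact: differentiable_cst.
  apply: differentiable_mulf; first exact: differentiable_cst.
  exact: differentiable_mulf.
have doff : differentiable (fun p =>
    slice_offdiag l (inv_y (chart_U p) (chart_V p)) (inv_z (chart_U p) (chart_V p))) q.
  apply/differentiable_mxP => i j; under eq_fun do rewrite mxE.
  by case: (_ == 0%N); [exact: dyE | apply: differentiable_bigsum => k; exact: dzE].
have doffT : differentiable (fun p => (slice_offdiag l (inv_y (chart_U p) (chart_V p))
    (inv_z (chart_U p) (chart_V p)))^T) q.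
  apply/differentiable_mxP => i j; under eq_fun do rewrite mxE.
  by move/differentiable_mxP: doff; apply.
have dcorner : differentiable (fun p =>
    zeta l (inv_z (chart_U p) (chart_V p)) *: corner R n l) q.
  apply/differentiable_mxP => i j; under eq_fun do rewrite mxE.
  by apply: differentiable_mulf => //; exact: differentiable_cst.
have ddiag k (v : chart_space R n -> 'rV[C]_k) : differentiable v q ->
    differentiable (fun p => diag_mx (v p)) q.
  move=> /differentiable_mxP dv; apply/differentiable_mxP => i j.
  under eq_fun do rewrite mxE.
  case: (i == j) => /=; last by under eq_fun do rewrite mulr0n; exact: differentiable_cst.
  by under eq_fun do rewrite mulr1n; exact: dv.
rewrite /inv_slice /slice_of /slice_shape.
do ![apply: differentiable_block_mx]; do ?[exact: differentiable_cst] => //.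
- apply: ddiag; apply/differentiable_mxP => i k; under eq_fun do rewrite mxE expr2.
  apply: differentiable_addf; first by move/differentiable_mxP: dd; apply.
  apply: differentiable_mulf; first exact: differentiable_cst.
  exact: differentiable_mulf.
- apply: ddiag; apply/differentiable_mxP => i k; under eq_fun do rewrite mxE.
  by move/differentiable_mxP: da; apply.
apply/differentiable_mxP => i j; under eq_fun do rewrite !mxE.
by apply: differentiable_oppf; exact: differentiable_mulf.
Qed.

End SliceCoordinates.

(** * The embedding *)

Theorem theorem12 (R : realType) (m n : nat) (m_ge1 : (1 <= m)%N)
    (n_le : (2 * n <= m)%N) (tau : m.-tuple R[i])
    (tau_uniq : uniq tau) (tau_neq0 : 0 \notin (tau : seq R[i])) :
  exists j : slice_fiber (m - n)%N n tau -> Hilb n (surface_eqn tau),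
    open_holomorphic_embedding
      (@hol_subset R _ (slice_fiber (m - n)%N n tau))
      (@hol_Hilb R n (surface_eqn tau)) j.
Proof.
have le_nm : (n <= m)%N by apply: leq_trans n_le; rewrite leq_pmull.
have le_nl : (n <= m - n)%N by rewrite leq_subRL // addnn -mul2n.
have l_gt0 : (0 < m - n)%N.
  rewrite subn_gt0; case: (posnP n) => [->//|n_gt0].
  by apply: leq_trans n_le; rewrite -[X in (X < _)%N]mul1n ltn_pmul2r.
have size_t : size tau = (m - n + n)%N by rewrite size_tuple subnK.
apply: (graph_embedding (pA := @coord_A R (m - n) n) (pU := @coord_U R (m - n) n)
  (pV := @coord_V R (m - n) n) (inv := @inv_slice R (m - n) n tau)).
- by move=> Y; exact: monic_of_monic.
- by move=> Y; exact: size_monic_of.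
- by move=> Y; exact: size_poly_u.
- by move=> Y; exact: size_poly_v.
- exact: differentiable_coord_A.
- exact: differentiable_coord_U.
- exact: differentiable_coord_V.
- by move=> Y; exact: coord_A_dvd.
- by move=> Y; exact: inv_sliceK.
- by move=> q; exact: differentiable_inv_slice.
- by move=> A U V; exact: inv_slice_fiber.
Qed.
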